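(* The optimization version of \textsc{Hedge Cluster Deletion} is \textsc{Min Horn Deletion}-complete under $A$-reductions.
   Context: A hedge graph is a simple graph whose edge set is partitioned into classes called hedges. The optimization version of \textsc{Hedge Cluster Deletion} asks, given a hedge graph $H$, for a minimum-size set $U$ of hedges whose deletion (removing all edges of these hedges) leaves a graph that is a disjoint union of cliques. \textsc{Min Horn Deletion}: given a Boolean CNF formula all of whose clauses are either unary or have three literals of which exactly one is negated, find a satisfying assignment minimizing the number of variables set to $1$. An optimization (minimization) problem $P$ $A$-reduces to $Q$ if there exist polynomial-time computable functions $F,G$ and a constant $\alpha$ such that for every instance $I$ of $P$: $F(I)$ is an instance of $Q$; $G(I,S')$ is a feasible solution of $I$ for every feasible solution $S'$ of $F(I)$; and if $S$ is an $r$-approximate solution for $F(I)$ then $G(I,S)$ is an $(\alpha r)$-approximate solution for $I$, for every $r\ge 1$. A problem $P$ is $Q$-complete under $A$-reductions if $P$ $A$-reduces to $Q$ and $Q$ $A$-reduces to $P$; a problem is \textsc{Min Horn Deletion}-complete if it is \textsc{Min Horn Deletion}-complete in this sense.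
   Formalization: Instances of Min Horn Deletion are restricted to satisfiable formulas: an unsatisfiable one such as x ∧ ¬x has no feasible solution, while every hedge graph has one (delete all hedges), so no A-reduction to Hedge Cluster Deletion could handle it. *)

(* Defs.v *)
From HB Require Import structures.
From mathcomp Require Import all_boot all_order all_algebra.
From mathcomp Require Import reals.

Set Implicit Arguments.
Unset Strict Implicit.
Unset Printing Implicit Defensive.

(** * Polynomial time: deterministic multi-tape Turing machines *)

Inductive direction := GoLeft | Stay | GoRight.

(* A two-way infinite tape with finitely many non-blank cells; the blank is
   [None].  [(l, r)] has the head on the first cell of [r]; [l] lists the cells
   to the left of the head, nearest first.  Beyond [l] and [r] all is blank. *)
Definition tape (A : Type) := (seq (option A) * seq (option A))%type.

(* Never stores a blank at the far end of a half-tape, so that a tape has only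
   one representation. *)
Definition tcons (A : Type) (a : option A) (s : seq (option A)) :=
  if a is None then (if s is [::] then [::] else a :: s) else a :: s.

Definition tread (A : Type) (t : tape A) : option A := head None t.2.

Definition twrite (A : Type) (a : option A) (t : tape A) : tape A :=
  (t.1, tcons a (behead t.2)).

Definition tmove (A : Type) (d : direction) (t : tape A) : tape A :=
  match d with
  | GoLeft => (behead t.1, tcons (head None t.1) t.2)
  | Stay => t
  | GoRight => (tcons (tread t) t.1, behead t.2)
  end.

(* The non-blank tape symbols are the bits [inl b], in which inputs and outputs
   are written, and the auxiliary symbols [inr a].  There are
   [tm_work.+1] tapes, tape [ord0] being the input and output tape. *)
Record turing_machine := TuringMachine {
  tm_work : nat;
  tm_aux : finType;
  tm_state : finType;
  tm_start : tm_state;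
  tm_halting : pred tm_state;
  tm_delta : tm_state -> {ffun 'I_tm_work.+1 -> option (bool + tm_aux)} ->
    tm_state *
    ('I_tm_work.+1 -> option (bool + tm_aux)%type * direction)
}.

Section Run.
Variable M : turing_machine.

Definition tm_config :=
  (tm_state M * ('I_(tm_work M).+1 -> tape (bool + tm_aux M)))%type.

Definition tm_step (c : tm_config) : tm_config :=
  if tm_halting c.1 then c else
  let: (q, act) := tm_delta c.1 [ffun i => tread (c.2 i)] in
  (q, fun i => tmove (act i).2 (twrite (act i).1 (c.2 i))).

Definition bits_tape (w : bitseq) : tape (bool + tm_aux M) :=
  ([::], [seq Some (inl b) | b <- w]).

Definition tm_init (w : bitseq) : tm_config :=
  (tm_start M, fun i => if i == ord0 then bits_tape w else ([::], [::])).

Definition tm_outputs_within (w v : bitseq) (t : nat) : Prop :=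
  let c := iter t tm_step (tm_init w) in
  tm_halting c.1 /\ c.2 ord0 = bits_tape v.

End Run.

(* The partial function [inp x |-> out x], with [x] ranging over [D], is
   computable in polynomial time. *)
Definition polytime (X : Type) (D : X -> Prop) (inp out : X -> bitseq) : Prop :=
  exists (M : turing_machine) (c d : nat), forall x : X, D x ->
    tm_outputs_within M (inp x) (out x) (c * size (inp x) ^ d + c).

(** * Minimization problems and A-reductions *)

Record min_problem := MinProblem {
  inst : Type;
  enc_inst : inst -> bitseq;
  sol : inst -> Type;
  enc_sol : forall I : inst, sol I -> bitseq;
  feasible : forall I : inst, sol I -> Prop;
  cost : forall I : inst, sol I -> nat
}.
Arguments enc_inst {m} I : rename.
Arguments sol {m} I : rename.
Arguments enc_sol {m I} S : rename.
Arguments feasible {m I} S : rename.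
Arguments cost {m I} S : rename.

Definition optimum (P : min_problem) (I : inst P) (v : nat) : Prop :=
  (exists2 S : sol I, feasible S & cost S = v) /\
  (forall S : sol I, feasible S -> v <= cost S).

Definition approximate (R : realType) (P : min_problem) (I : inst P) (r : R)
    (S : sol I) : Prop :=
  feasible S /\ exists2 v, optimum I v & ((cost S)%:R <= r * v%:R)%R.

Definition A_reduces (R : realType) (P Q : min_problem) : Prop :=
  exists (F : inst P -> inst Q)
         (G : forall I : inst P, sol (F I) -> sol I)
         (alpha : R),
  [/\ polytime (fun=> True) (fun I => enc_inst I) (fun I => enc_inst (F I)),
      (* the input of G is the pair (I, S'); [enc_inst] being prefix-free for
         both problems below, concatenation is a faithful code for pairs *)
      polytime (fun x : {I : inst P & sol (F I)} => feasible (projT2 x))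
        (fun x => enc_inst (projT1 x) ++ enc_sol (projT2 x))
        (fun x => enc_sol (G (projT1 x) (projT2 x))),
      forall (I : inst P) (S : sol (F I)), feasible S -> feasible (G I S)
    & forall (I : inst P) (r : R) (S : sol (F I)), (1 <= r)%R ->
        approximate r S -> approximate (alpha * r)%R (G I S)].

(* [P] is [Q]-complete under A-reductions. *)
Definition A_complete (R : realType) (P Q : min_problem) : Prop :=
  A_reduces R P Q /\ A_reduces R Q P.

(** * Prefix-free codes *)

(* Numbers are written in unary.  They only occur as numbers of vertices,
   hedges and variables, and as indices below these, so this changes the size
   of an instance by a polynomial at most. *)
Definition enc_nat (n : nat) : bitseq := rcons (nseq n true) false.

Definition enc_seq (T : Type) (enc : T -> bitseq) (s : seq T) : bitseq :=
  rcons (flatten [seq true :: enc x | x <- s]) false.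

(** * Hedge Cluster Deletion *)

(* A simple graph on ['I_hg_order], given by its list of edges; [(u, v, h)] is
   the edge [uv], stored once with [u < v], and lying in the hedge [h].  The
   last field says that no hedge is empty: hedges are classes of a partition. *)
Record hedge_graph := HedgeGraph {
  hg_order : nat;
  hg_hedges : nat;
  hg_edges : seq ('I_hg_order * 'I_hg_order * 'I_hg_hedges);
  hg_oriented : all (fun e : 'I_hg_order * 'I_hg_order * 'I_hg_hedges =>
                       e.1.1 < e.1.2) hg_edges;
  hg_simple : uniq [seq e.1 | e <- hg_edges];
  hg_nonempty : [forall h, h \in [seq e.2 | e <- hg_edges]]
}.

(* Adjacency after deleting all the edges of the hedges in [U]. *)
Definition hg_delete (H : hedge_graph) (U : {set 'I_(hg_hedges H)}) :
    rel 'I_(hg_order H) :=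
  fun x y => has (fun e => (e.2 \notin U) &&
                           ((e.1 == (x, y)) || (e.1 == (y, x)))) (hg_edges H).

Definition disjoint_union_of_cliques (V : finType) (adj : rel V) : Prop :=
  exists2 P : {set {set V}}, partition P [set: V] &
    forall x y : V,
      adj x y = (x != y) && [exists B in P, (x \in B) && (y \in B)].

Definition enc_hedge_graph (H : hedge_graph) : bitseq :=
  enc_nat (hg_order H) ++ enc_nat (hg_hedges H) ++
  enc_seq (fun e : 'I_(hg_order H) * 'I_(hg_order H) * 'I_(hg_hedges H) =>
             enc_nat e.1.1 ++ enc_nat e.1.2 ++ enc_nat e.2) (hg_edges H).

Definition HedgeClusterDeletion : min_problem := {|
  inst := hedge_graph;
  enc_inst := enc_hedge_graph;
  sol := fun H => {set 'I_(hg_hedges H)};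
  enc_sol := fun H U => [seq h \in U | h <- enum 'I_(hg_hedges H)];
  feasible := fun H U => disjoint_union_of_cliques (hg_delete U);
  cost := fun H U => #|U|
|}.

(** * Min Horn Deletion *)

(* [(true, x)] is the literal x and [(false, x)] its negation; a clause is
   the disjunction of a list of distinct literals. *)
Definition literal (n : nat) := (bool * 'I_n)%type.

Definition horn_clause (n : nat) (c : seq (literal n)) : bool :=
  uniq c &&
  ((size c == 1) || ((size c == 3) && (count (fun l => ~~ l.1) c == 1))).

Definition satisfies (n : nat) (a : {ffun 'I_n -> bool})
    (f : seq (seq (literal n))) : bool :=
  all (has (fun l : literal n => a l.2 == l.1)) f.

(* Instances are the formulas of the prescribed shape that have a satisfying
   assignment.  An unsatisfiable formula, which the negated unary clauses
   allow, has no solution at all and could not be reduced to a problem whose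
   instances are all feasible. *)
Record horn_formula := HornFormula {
  hf_vars : nat;
  hf_clauses : seq (seq (literal hf_vars));
  hf_shape : all (@horn_clause hf_vars) hf_clauses;
  hf_satisfiable : [exists a, satisfies a hf_clauses]
}.

Definition enc_horn_formula (f : horn_formula) : bitseq :=
  enc_nat (hf_vars f) ++
  enc_seq (enc_seq (fun l : literal (hf_vars f) => l.1 :: enc_nat l.2))
    (hf_clauses f).

Definition MinHornDeletion : min_problem := {|
  inst := horn_formula;
  enc_inst := enc_horn_formula;
  sol := fun f => {ffun 'I_(hf_vars f) -> bool};
  enc_sol := fun f a => [seq a x | x <- enum 'I_(hf_vars f)];
  feasible := fun f a => satisfies a (hf_clauses f);
  cost := fun f a => #|[set x | a x]|
|}.

(* Main.v *)
(* A cut leaves a cluster graph iff it leaves no induced path on three vertices.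
   So a path with edges in the hedges a, b says a \/ b if its ends are not
   adjacent, and c -> a \/ b if they are joined by an edge in c.  This
   is Min Horn Deletion, but for clauses that are too short, which are padded
   with constants.

   Conversely, a triangle with edges in the hedges a, b, c expresses that not
   exactly one of them is deleted, hence b -> a if c = a, and disjoint triangles
   express any Horn formula with the help of one auxiliary hedge per clause.
   Every cut extends to all hedges, whereas a formula may have negative unit
   clauses; a cut is therefore turned into a model by unit propagation.

   Both reductions are list programs.  They are assembled from combinators for
   polynomial time, in particular a fold whose accumulator is bounded, each of
   which is realized by a machine with three stacks that replaces the code of
   the argument on top of the first stack by the code of the value and restores
   everything below. *)

Require Import Defs.
From mathcomp Require Import all_boot all_order all_algebra.
From mathcomp Require Import boolp reals.
From mathcomp Require Import zify ring.

Set Implicit Arguments.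
Unset Strict Implicit.
Unset Printing Implicit Defensive.

Import Order.TTheory GRing.Theory Num.Theory.

Local Open Scope nat_scope.

(** * Three-stack programs and their compilation to Turing machines *)

(** Approximation ratios are purely multiplicative. So an instance of optimum 0 must go to an
    instance of optimum 0, and every additive overhead has to be charged to a positive optimum; this
    gives the constant 2 in both directions. From graphs to formulas the only overhead is one
    variable for the constant 1, which is set only if the cut is nonempty. From formulas to graphs
    it is one auxiliary hedge per clause. With [N] copies of each variable, [N] exceeding the number
    of clauses, a model of cost [k > 0] becomes a cut of size less than [N * k + N <= 2 * N * k],
    while a model of cost 0 deletes no auxiliary hedge. Conversely, the variables deleted by a cut
    number at most its size divided by [N], whatever happens to the auxiliary hedges. All
    computation takes place on raw data made of numbers, pairs and lists, whose codes agree bit for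
    bit with those of the instances; the invariants of instances are recovered afterwards by lifting
    lemmas. *)

Definition sym := (bool + unit)%type.

Inductive stack := X0 | X1 | X2.

Definition store := (seq sym * seq sym * seq sym)%type.

Definition get (s : store) (i : stack) : seq sym :=
  match i with X0 => s.1.1 | X1 => s.1.2 | X2 => s.2 end.

Definition put (s : store) (i : stack) (w : seq sym) : store :=
  match i with
  | X0 => (w, s.1.2, s.2) | X1 => (s.1.1, w, s.2) | X2 => (s.1.1, s.1.2, w)
  end.

Inductive cmd :=
| Skip
| Push of stack & sym
| Pop of stack
| Seq of cmd & cmd
| If of stack & pred (option sym) & cmd & cmd
| While of stack & pred (option sym) & cmd.

Definition top (s : store) (i : stack) : option sym := ohead (get s i).

(** The last index is the exact number of machine steps of the compiled code: a push takes two
    moves, the true branch of [If] pays for the jump over the other branch, and each round of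
    [While] pays for the test and the jump back. *)
Inductive run : cmd -> store -> store -> nat -> Prop :=
| RunSkip s : run Skip s s 0
| RunPush i a s : run (Push i a) s (put s i (a :: get s i)) 2
| RunPop i s : run (Pop i) s (put s i (behead (get s i))) 1
| RunSeq c1 c2 s s1 s2 t1 t2 :
    run c1 s s1 t1 -> run c2 s1 s2 t2 -> run (Seq c1 c2) s s2 (t1 + t2)
| RunIfT i (P : pred (option sym)) c1 c2 s s' t :
    P (top s i) -> run c1 s s' t -> run (If i P c1 c2) s s' t.+2
| RunIfF i (P : pred (option sym)) c1 c2 s s' t :
    ~~ P (top s i) -> run c2 s s' t -> run (If i P c1 c2) s s' t.+1
| RunWhileT i (P : pred (option sym)) c s s1 s2 t1 t2 :
    P (top s i) -> run c s s1 t1 -> run (While i P c) s1 s2 t2 ->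
    run (While i P c) s s2 (t1 + t2).+2
| RunWhileF i (P : pred (option sym)) c s :
    ~~ P (top s i) -> run (While i P c) s s 1.

Inductive instr :=
| IPush of stack & sym
| IPop of stack
| IJump of stack & (option sym -> nat).

Fixpoint csize (c : cmd) : nat :=
  match c with
  | Skip => 0
  | Push _ _ | Pop _ => 1
  | Seq c1 c2 => csize c1 + csize c2
  | If _ _ c1 c2 => (csize c1 + csize c2).+2
  | While _ _ c => (csize c).+2
  end.

(* Jump targets are absolute; [pc] is the address of the first instruction. *)
Fixpoint compile (pc : nat) (c : cmd) : seq instr :=
  match c with
  | Skip => [::]
  | Push i a => [:: IPush i a]
  | Pop i => [:: IPop i]
  | Seq c1 c2 => compile pc c1 ++ compile (pc + csize c1) c2
  | If i P c1 c2 =>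
      IJump i (fun o => if P o then pc.+1 else pc + (csize c1).+2) ::
      compile pc.+1 c1 ++
      IJump i (fun=> pc + (csize c1 + csize c2).+2) ::
      compile (pc + (csize c1).+2) c2
  | While i P c =>
      IJump i (fun o => if P o then pc.+1 else pc + (csize c).+2) ::
      rcons (compile pc.+1 c) (IJump i (fun=> pc))
  end.

Lemma size_compile c pc : size (compile pc c) = csize c.
Proof.
elim: c pc => //= [c1 IH1 c2 IH2|i P c1 IH1 c2 IH2|i P c IH] pc.
- by rewrite size_cat IH1 IH2.
- by rewrite size_cat /= IH1 IH2 addnS.
- by rewrite size_rcons IH.
Qed.

Definition tape_of (i : stack) : 'I_3 :=
  match i with X0 => ord0 | X1 => lift ord0 ord0 | X2 => ord_max end.

Lemma tape_of_inj : injective tape_of.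
Proof. by case; case. Qed.

Section Compile.
Variable C : seq instr.

(* The flag in a state is set between the two moves that perform a push. *)
Definition stack_machine : turing_machine := {|
  tm_work := 2;
  tm_aux := unit;
  tm_state := ('I_(size C).+1 * bool)%type;
  tm_start := (ord0, false);
  tm_halting := fun q => q.1 == ord_max;
  tm_delta := fun q rd =>
    match nth (IPop X0) C q.1 with
    | IPush i a =>
        if q.2
        then ((inord q.1.+1, false),
              fun j => (if j == tape_of i then Some a else rd j, Stay))
        else ((q.1, true),
              fun j => (rd j, if j == tape_of i then GoLeft else Stay))
    | IPop i =>
        ((inord q.1.+1, false),
         fun j => if j == tape_of i then (None, GoRight) else (rd j, Stay))
    | IJump i f =>
        ((inord (f (rd (tape_of i))), false), fun j => (rd j, Stay))
    end |}.

Local Notation M := stack_machine.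

(** The head rests on the top of the stack and nothing lies to its left. A push therefore moves left
    onto a fresh blank first and writes in a second step. *)
Definition stack_tape (w : seq sym) : tape sym := ([::], [seq Some a | a <- w]).

Definition represents (cf : tm_config M) (pc : nat) (s : store) : Prop :=
  cf.1 = (inord pc, false) /\
  forall i, cf.2 (tape_of i) = stack_tape (get s i).

Lemma tread_stack w : tread (stack_tape w) = ohead w.
Proof. by case: w. Qed.

Lemma twrite_stack w : twrite (ohead w) (stack_tape w) = stack_tape w.
Proof. by case: w. Qed.

(** The erased cell is passed as a blank, which [tcons] absorbs at the end of a half-tape, so the
    left part stays empty. *)
Lemma pop_stack w :
  tmove GoRight (twrite None (stack_tape w)) = stack_tape (behead w).
Proof. by case: w => [|a [|b w]]. Qed.

Lemma push_stack a w :
  twrite (Some a) (tmove GoLeft (stack_tape w)) = stack_tape (a :: w).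
Proof. by case: w. Qed.

Lemma get_put s i w j :
  get (put s i w) j = if tape_of j == tape_of i then w else get s j.
Proof. by case: i j => [] []. Qed.

Lemma step_push pc s cf i a :
  pc < size C -> represents cf pc s -> nth (IPop X0) C pc = IPush i a ->
  represents (iter 2 (@tm_step M) cf) pc.+1 (put s i (a :: get s i)).
Proof.
move=> lt_pc; case: cf => q T [/= -> rT] Cpc /=.
have nh : (inord pc == ord_max :> 'I_(size C).+1) = false.
  by rewrite -val_eqE /= inordK ?ltn_eqF // ltnS ltnW.
rewrite {2}/tm_step /= nh inordK ?Cpc; last by rewrite ltnS ltnW.
rewrite /tm_step /= nh inordK ?Cpc; last by rewrite ltnS ltnW.
split=> //= j; rewrite !ffunE rT tread_stack twrite_stack get_put.
case: eqP => [/tape_of_inj ->|_]; first exact: push_stack.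
by rewrite /= tread_stack twrite_stack.
Qed.

Lemma step_pop pc s cf i :
  pc < size C -> represents cf pc s -> nth (IPop X0) C pc = IPop i ->
  represents (tm_step cf) pc.+1 (put s i (behead (get s i))).
Proof.
move=> lt_pc; case: cf => q T [/= -> rT] Cpc.
have nh : (inord pc == ord_max :> 'I_(size C).+1) = false.
  by rewrite -val_eqE /= inordK ?ltn_eqF // ltnS ltnW.
rewrite /tm_step /= nh inordK ?Cpc; last by rewrite ltnS ltnW.
split=> //= j; rewrite !ffunE rT tread_stack get_put.
case: eqP => [/tape_of_inj ->|_] /=; first exact: pop_stack.
by rewrite twrite_stack.
Qed.

Lemma step_jump pc s cf i f :
  pc < size C -> represents cf pc s -> nth (IPop X0) C pc = IJump i f ->
  represents (tm_step cf) (f (top s i)) s.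
Proof.
move=> lt_pc; case: cf => q T [/= -> rT] Cpc.
have nh : (inord pc == ord_max :> 'I_(size C).+1) = false.
  by rewrite -val_eqE /= inordK ?ltn_eqF // ltnS ltnW.
rewrite /tm_step /= nh inordK ?Cpc; last by rewrite ltnS ltnW.
split=> /= [|j]; first by rewrite ffunE rT tread_stack.
by rewrite !ffunE rT tread_stack twrite_stack.
Qed.

Definition code_at (pc : nat) (D : seq instr) : Prop :=
  exists pre post, C = pre ++ D ++ post /\ size pre = pc.

Lemma code_at_catl pc D1 D2 : code_at pc (D1 ++ D2) -> code_at pc D1.
Proof.
by move=> [pre [post [eC <-]]]; exists pre, (D2 ++ post); rewrite eC -catA.
Qed.

Lemma code_at_catr pc D1 D2 :
  code_at pc (D1 ++ D2) -> code_at (pc + size D1) D2.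
Proof.
move=> [pre [post [eC <-]]]; exists (pre ++ D1), post.
by rewrite size_cat eC -!catA.
Qed.

Lemma code_at_nth pc x D :
  code_at pc (x :: D) -> pc < size C /\ nth (IPop X0) C pc = x.
Proof.
move=> [pre [post [-> <-]]].
by rewrite size_cat /= nth_cat ltnn subnn /=; split=> //; lia.
Qed.

Lemma code_at_cons pc x D : code_at pc (x :: D) -> code_at pc.+1 D.
Proof. by rewrite -cat1s => /code_at_catr; rewrite addn1. Qed.

(** The induction is on the run and not on the command, because a loop runs its own code again from
    the same address. *)
Lemma run_compile c s s' t : run c s s' t ->
  forall pc cf, code_at pc (compile pc c) -> represents cf pc s ->
  represents (iter t (@tm_step M) cf) (pc + csize c) s'.
Proof.
elim=> {c s s' t} /=.
- by move=> s pc cf _; rewrite addn0.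
- move=> i a s pc cf /code_at_nth[lt_pc Cpc] r.
  by rewrite addn1; exact: step_push.
- move=> i s pc cf /code_at_nth[lt_pc Cpc] r.
  by rewrite addn1; exact: step_pop.
- move=> c1 c2 s s1 s2 t1 t2 _ IH1 _ IH2 pc cf Cpc r.
  rewrite addnC iterD addnA; apply: (IH2); last first.
    by apply: IH1 => //; exact: code_at_catl Cpc.
  by move/code_at_catr: Cpc; rewrite size_compile.
- move=> i P c1 c2 s s' t Ps _ IH pc cf Cpc r.
  have [lt_pc Cpc0] := code_at_nth Cpc.
  have {r} := step_jump lt_pc r Cpc0; rewrite Ps => r.
  move/code_at_cons: Cpc => Cpc.
  have {r} := IH _ _ (code_at_catl Cpc) r.
  move/code_at_catr: Cpc; rewrite size_compile => /code_at_nth[lt1 C1] r.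
  by rewrite -iterS iterSr; exact: (step_jump lt1 r C1).
- move=> i P c1 c2 s s' t Ps _ IH pc cf Cpc r.
  have [lt_pc Cpc0] := code_at_nth Cpc.
  have {r} := step_jump lt_pc r Cpc0; rewrite (negPf Ps) => r.
  move/code_at_cons/code_at_catr/code_at_cons: Cpc; rewrite size_compile.
  rewrite addSn -addnS -addnS => Cpc.
  by rewrite -iterS iterSr -2!addSn addnA; exact: IH.
- move=> i P c s s1 s2 t1 t2 Ps _ IH1 _ IH2 pc cf Cpc r.
  have Cpc' := Cpc; have [lt_pc Cpc0] := code_at_nth Cpc.
  have {r} := step_jump lt_pc r Cpc0; rewrite Ps => r.
  move/code_at_cons: Cpc; rewrite -cats1 => Cpc.
  have {r} := IH1 _ _ (code_at_catl Cpc) r.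
  move/code_at_catr: Cpc; rewrite size_compile => /code_at_nth[lt1 C1] r.
  have := IH2 _ _ Cpc' (step_jump lt1 r C1).
  rewrite -[tm_step (iter t1 _ _)]/(iter t1.+1 _ _) -iterSr -iterD.
  by rewrite addnC !addSn.
- move=> i P c s Ps pc cf Cpc r.
  have [lt_pc Cpc0] := code_at_nth Cpc.
  by have {r} := step_jump lt_pc r Cpc0; rewrite (negPf Ps).
Qed.

End Compile.

Definition bits (w : bitseq) : seq sym := [seq inl b | b <- w].

(** A halted configuration is stationary, so an upper bound on the time is enough; garbage on the
    other two stacks is harmless since only tape [ord0] is read. *)
Lemma run_outputs_within c w v t t' y z :
  run c (bits w, [::], [::]) (bits v, y, z) t -> t <= t' ->
  tm_outputs_within (stack_machine (compile 0 c)) w v t'.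
Proof.
move=> rc le_t; set C := compile 0 c; set M := stack_machine C.
have at0 : code_at C 0 (compile 0 c).
  by exists [::], [::]; rewrite cats0.
have r0 : represents (tm_init M w) 0 (bits w, [::], [::]).
  split=> /= [|[]] //=; last 1 first.
    by rewrite /bits_tape /bits /stack_tape -map_comp.
  by congr pair; apply: val_inj; rewrite /= inordK.
have [q1 T1] := run_compile rc at0 r0; rewrite add0n in q1.
have haltS (cf : tm_config M) : tm_halting cf.1 -> forall k, iter k (@tm_step M) cf = cf.
  by move=> h; elim=> // k /= ->; rewrite /tm_step h.
have h1 : tm_halting (iter t (@tm_step M) (tm_init M w)).1.
  by rewrite q1 /= -val_eqE /= inordK ?size_compile.
rewrite /tm_outputs_within -(subnK le_t) iterD haltS //; split=> //.
by have /= -> := T1 X0; rewrite /bits_tape /bits /stack_tape -map_comp.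
Qed.

(** * Basic stack programs *)

(** Relaxing the exact time to an upper bound allows rounding in every estimate below. *)
Definition runs (c : cmd) (s s' : store) (t : nat) : Prop :=
  exists2 t', t' <= t & run c s s' t'.

Lemma runs_le c s s' t t' : runs c s s' t -> t <= t' -> runs c s s' t'.
Proof. by move=> [u le_u rc] le_t; exists u; first exact: leq_trans le_t. Qed.

Lemma runs_skip s : runs Skip s s 0. Proof. by exists 0; last exact: RunSkip. Qed.

Lemma runs_push i a s : runs (Push i a) s (put s i (a :: get s i)) 2.
Proof. by exists 2; last exact: RunPush. Qed.

Lemma runs_pop i s : runs (Pop i) s (put s i (behead (get s i))) 1.
Proof. by exists 1; last exact: RunPop. Qed.

Lemma runs_seq c1 c2 s s1 s2 t1 t2 :
  runs c1 s s1 t1 -> runs c2 s1 s2 t2 -> runs (Seq c1 c2) s s2 (t1 + t2).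
Proof.
move=> [u1 le1 r1] [u2 le2 r2]; exists (u1 + u2); first exact: leq_add.
exact: RunSeq r1 r2.
Qed.

Lemma runs_if i P c1 c2 s s' t :
  runs (if P (top s i) then c1 else c2) s s' t -> runs (If i P c1 c2) s s' t.+2.
Proof.
case: ifP => Ps [u le_u ru]; first by exists u.+2; last exact: RunIfT ru.
by exists u.+1; [lia | apply: RunIfF ru; rewrite Ps].
Qed.

Lemma runs_while i (P : pred (option sym)) c s s1 s2 t1 t2 :
  P (top s i) -> runs c s s1 t1 -> runs (While i P c) s1 s2 t2 ->
  runs (While i P c) s s2 (t1 + t2).+2.
Proof.
move=> Ps [u1 le1 r1] [u2 le2 r2]; exists (u1 + u2).+2; first by lia.
exact: RunWhileT r1 r2.
Qed.

Lemma runs_done i (P : pred (option sym)) c s :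
  ~~ P (top s i) -> runs (While i P c) s s 1.
Proof. by move=> Ps; exists 1; last exact: RunWhileF. Qed.

Definition store_size (s : store) := size s.1.1 + size s.1.2 + size s.2.

(** Each step adds at most one symbol. Output sizes thus follow from running times and need no
    analysis of their own. *)
Lemma run_size c s s' t :
  run c s s' t -> store_size s' <= store_size s + t.
Proof.
elim=> {c s s' t} /=; rewrite /store_size.
- by move=> s; lia.
- by move=> i a [[x y] z]; case: i => /=; lia.
- by move=> i [[x y] z]; case: i => /=; rewrite size_behead; lia.
all: by move=> *; lia.
Qed.

Lemma runs_size c s s' t :
  runs c s s' t -> store_size s' <= store_size s + t.
Proof. by move=> [u le_u /run_size]; lia. Qed.

Definition mark : sym := inr tt.

Definition is_true_bit (o : option sym) : bool :=
  if o is Some (inl b) then b else false.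

Definition is_bit (o : option sym) : bool :=
  if o is Some (inl _) then true else false.

(** A pushed symbol is fixed in the program text, so the popped bit is remembered by the branch
    taken. *)
Definition xfer (i j : stack) : cmd :=
  If i is_true_bit (Seq (Pop i) (Push j (inl true)))
                   (Seq (Pop i) (Push j (inl false))).

Definition xfer2 (i j k : stack) : cmd :=
  If i is_true_bit
    (Seq (Pop i) (Seq (Push j (inl true)) (Push k (inl true))))
    (Seq (Pop i) (Seq (Push j (inl false)) (Push k (inl false)))).

Definition move_bits (i j : stack) : cmd := While i is_bit (xfer i j).

Lemma runs_xfer i j s b w : get s i = inl b :: w ->
  let s1 := put s i w in runs (xfer i j) s (put s1 j (inl b :: get s1 j)) 5.
Proof.
move=> si s1; apply: (@runs_if _ _ _ _ _ _ (1 + 2)).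
have -> : is_true_bit (top s i) = b by rewrite /top si.
have es1 : s1 = put s i (behead (get s i)) by rewrite si.
case: b si => si.
  by apply: runs_seq; [exact: runs_pop|rewrite -es1; exact: runs_push].
by apply: runs_seq; [exact: runs_pop|rewrite -es1; exact: runs_push].
Qed.

Lemma runs_xfer10 b x y z :
  runs (xfer X1 X0) (x, inl b :: y, z) (inl b :: x, y, z) 5.
Proof. by have := @runs_xfer X1 X0 (x, inl b :: y, z) b y erefl. Qed.

Lemma runs_xfer01 b x y z :
  runs (xfer X0 X1) (inl b :: x, y, z) (x, inl b :: y, z) 5.
Proof. by have := @runs_xfer X0 X1 (inl b :: x, y, z) b x erefl. Qed.

Lemma runs_xfer02 b x y z :
  runs (xfer X0 X2) (inl b :: x, y, z) (x, y, inl b :: z) 5.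
Proof. by have := @runs_xfer X0 X2 (inl b :: x, y, z) b x erefl. Qed.

Lemma runs_xfer12 b x y z :
  runs (xfer X1 X2) (x, inl b :: y, z) (x, y, inl b :: z) 5.
Proof. by have := @runs_xfer X1 X2 (x, inl b :: y, z) b y erefl. Qed.

Lemma runs_xfer21 b x y z :
  runs (xfer X2 X1) (x, y, inl b :: z) (x, inl b :: y, z) 5.
Proof. by have := @runs_xfer X2 X1 (x, y, inl b :: z) b z erefl. Qed.

Lemma runs_xfer102 b x y z :
  runs (xfer2 X1 X0 X2) (x, inl b :: y, z) (inl b :: x, y, inl b :: z) 7.
Proof.
apply: (@runs_if _ _ _ _ _ _ (1 + (2 + 2))).
case: b => /=; apply: runs_seq; try exact: runs_pop;
  by apply: runs_seq; exact: runs_push.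
Qed.

Arguments bits : simpl never.

Lemma bits_cons b u : bits (b :: u) = inl b :: bits u. Proof. by []. Qed.

Lemma bits_cat u v : bits (u ++ v) = bits u ++ bits v.
Proof. exact: map_cat. Qed.

Lemma size_bits u : size (bits u) = size u.
Proof. exact: size_map. Qed.

(** In the store [f u v], the bits [u] are still to be processed and [v] are the processed ones,
    latest first; hence the reversal. The 2 added to [d] is the loop overhead. *)
Lemma while_bits i c d u (f : bitseq -> bitseq -> store) :
  (forall b u v, top (f (b :: u) v) i = Some (inl b)) ->
  (forall v, ~~ is_bit (top (f [::] v) i)) ->
  (forall b u v, runs c (f (b :: u) v) (f u (b :: v)) d) ->
  runs (While i is_bit c) (f u [::]) (f [::] (rev u)) (d.+2 * size u).+1.
Proof.
move=> ftop fnil step; rewrite /rev.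
(* The two lists generalized are the initial accumulator and the one inside the unfolded [rev]; the
   other empty list is the exhausted input and must stay. *)
move: {1 3}[::] => v; elim: u v => [|b u IH] v /=.
  by rewrite muln0; apply: runs_done.
apply: (@runs_le _ _ _ (d + (d.+2 * size u).+1).+2); last by lia.
by apply: runs_while (step _ _ _) (IH _); rewrite ftop.
Qed.

Lemma runs_move21 u x y z : 
  runs (move_bits X2 X1) (x, y, bits u ++ mark :: z)
    (x, bits (rev u) ++ y, mark :: z) (7 * size u).+1.
Proof.
apply: (@while_bits X2 _ 5 u (fun u v => (x, bits v ++ y, bits u ++ mark :: z))) => //.
by move=> b u' v; exact: runs_xfer21.
Qed.

Lemma runs_move10 u x y z :
  runs (move_bits X1 X0) (x, bits u ++ mark :: y, z)
    (bits (rev u) ++ x, mark :: y, z) (7 * size u).+1.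
Proof.
apply: (@while_bits X1 _ 5 u (fun u v => (bits v ++ x, bits u ++ mark :: y, z))) => //.
by move=> b u' v; exact: runs_xfer10.
Qed.

Lemma runs_move12 u x y z :
  runs (move_bits X1 X2) (x, bits u ++ mark :: y, z)
    (x, mark :: y, bits (rev u) ++ z) (7 * size u).+1.
Proof.
apply: (@while_bits X1 _ 5 u (fun u v => (x, bits u ++ mark :: y, bits v ++ z))) => //.
by move=> b u' v; exact: runs_xfer12.
Qed.

Lemma runs_move102 u x y z :
  runs (While X1 is_bit (xfer2 X1 X0 X2)) (x, bits u ++ mark :: y, z)
    (bits (rev u) ++ x, mark :: y, bits (rev u) ++ z) (9 * size u).+1.
Proof.
apply: (@while_bits X1 _ 7 u
  (fun u v => (bits v ++ x, bits u ++ mark :: y, bits v ++ z))) => //.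
by move=> b u' v; exact: runs_xfer102.
Qed.

Lemma runs_drop1 u x y z :
  runs (While X1 is_bit (Pop X1)) (x, bits u ++ mark :: y, z)
    (x, mark :: y, z) (3 * size u).+1.
Proof.
apply: (@while_bits X1 _ 1 u (fun u v => (x, bits u ++ mark :: y, z))) => //.
by move=> b u' v; exact: runs_pop.
Qed.

(** * Self-delimiting codes *)

(* [mover] pops one codeword from stack [X0] and pushes its bits, in reverse
   order, on [X1]. *)
Structure encType := EncType {
  carrier :> Type;
  encode : carrier -> bitseq;
  mover : cmd;
  mover_encode : forall a w y z,
    runs mover (bits (encode a) ++ w, y, z)
      (w, bits (rev (encode a)) ++ y, z) (7 * size (encode a))
}.
Arguments mover e : clear implicits.

Definition code (A : encType) (a : A) : bitseq := encode a.
Arguments code : simpl never.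

Lemma moverP (A : encType) (a : A) w y z :
  runs (mover A) (bits (code a) ++ w, y, z)
    (w, bits (rev (code a)) ++ y, z) (7 * size (code a)).
Proof. exact: mover_encode. Qed.

(** With the empty code, a list of units has the same code as a unary number, so arithmetic reduces
    to list programs. *)
Definition unit_code (_ : unit) : bitseq := [::].

Lemma unit_moverP (a : unit) w y z :
  runs Skip (bits (unit_code a) ++ w, y, z)
    (w, bits (rev (unit_code a)) ++ y, z) (7 * size (unit_code a)).
Proof. exact: runs_skip. Qed.

Canonical unit_encType := EncType unit_moverP.

Definition bool_code (b : bool) : bitseq := [:: b].

Lemma bool_moverP b w y z :
  runs (xfer X0 X1) (bits (bool_code b) ++ w, y, z)
    (w, bits (rev (bool_code b)) ++ y, z) (7 * size (bool_code b)).
Proof. by apply: runs_le (runs_xfer01 _ _ _ _) _. Qed.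

Canonical bool_encType := EncType bool_moverP.

Section Prod.
Variables A B : encType.

Definition prod_code (p : A * B) : bitseq := code p.1 ++ code p.2.

Lemma prod_moverP (p : A * B) w y z :
  runs (Seq (mover A) (mover B)) (bits (prod_code p) ++ w, y, z)
    (w, bits (rev (prod_code p)) ++ y, z) (7 * size (prod_code p)).
Proof.
rewrite /prod_code size_cat mulnDr rev_cat !bits_cat -!catA.
exact: runs_seq (moverP _ _ _ _) (moverP _ _ _ _).
Qed.

Canonical prod_encType := EncType prod_moverP.
End Prod.

Lemma enc_seq_cons T (enc : T -> bitseq) x s :
  enc_seq enc (x :: s) = true :: enc x ++ enc_seq enc s.
Proof. by rewrite /enc_seq /= -rcons_cat. Qed.

Lemma runs_mover_seq T (enc : T -> bitseq) c :
  (forall a w y z, runs c (bits (enc a) ++ w, y, z)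
      (w, bits (rev (enc a)) ++ y, z) (7 * size (enc a))) ->
  forall s w y z,
  runs (Seq (While X0 is_true_bit (Seq (xfer X0 X1) c)) (xfer X0 X1))
    (bits (enc_seq enc s) ++ w, y, z)
    (w, bits (rev (enc_seq enc s)) ++ y, z) (7 * size (enc_seq enc s)).
Proof.
move=> cP s w y z.
set t := size (enc_seq enc s).
(* The terminating bit costs 1 for leaving the loop and 5 for its transfer, within its share of
   7. *)
apply: (@runs_le _ _ _ ((7 * t.-1).+1 + 5)); last first.
  by rewrite /t /enc_seq size_rcons /=; lia.
have -> : rev (enc_seq enc s) = false :: rev (flatten [seq true :: enc x | x <- s]).
  by rewrite rev_rcons.
apply: (@runs_seq _ _ _ (inl false :: w,
    bits (rev (flatten [seq true :: enc x | x <- s])) ++ y, z)) (runs_xfer01 _ _ _ _).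
rewrite {}/t; elim: s y => [|x s IH] y.
  exact: runs_done.
rewrite enc_seq_cons bits_cons bits_cat cat_cons -catA /=.
have -> : rev (true :: enc x ++ flatten [seq true :: enc x0 | x0 <- s]) =
          rev (flatten [seq true :: enc x0 | x0 <- s]) ++ rev (enc x) ++ [:: true].
  by rewrite rev_cons rev_cat -cats1 catA.
rewrite !bits_cat -!catA.
apply: (@runs_le _ _ _
  ((5 + 7 * size (enc x)) + (7 * (size (enc_seq enc s)).-1).+1).+2).
  apply: (@runs_while _ _ _ _ (bits (enc_seq enc s) ++ w,
      bits (rev (enc x)) ++ inl true :: y, z)) => //.
  by apply: runs_seq; [exact: runs_xfer01 | exact: cP].
by rewrite size_cat [size (enc_seq enc s)]size_rcons /=; lia.
Qed.

Section Seq.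
Variable A : encType.

Lemma seq_moverP (s : seq A) w y z :
  runs (Seq (While X0 is_true_bit (Seq (xfer X0 X1) (mover A))) (xfer X0 X1))
    (bits (enc_seq (@code A) s) ++ w, y, z)
    (w, bits (rev (enc_seq (@code A) s)) ++ y, z) (7 * size (enc_seq (@code A) s)).
Proof. exact/runs_mover_seq/moverP. Qed.

Canonical seq_encType := EncType seq_moverP.
End Seq.

Lemma enc_nat_seq n : enc_nat n = enc_seq unit_code (nseq n tt).
Proof. by congr rcons; elim: n => //= n ->. Qed.

Lemma nat_moverP n w y z :
  runs (mover (seq unit)) (bits (enc_nat n) ++ w, y, z)
    (w, bits (rev (enc_nat n)) ++ y, z) (7 * size (enc_nat n)).
Proof. rewrite enc_nat_seq; exact: moverP. Qed.

Canonical nat_encType := EncType nat_moverP.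

Lemma runs_push0 a x y z : runs (Push X0 a) (x, y, z) (a :: x, y, z) 2.
Proof. exact: runs_push. Qed.

Lemma runs_push1 a x y z : runs (Push X1 a) (x, y, z) (x, a :: y, z) 2.
Proof. exact: runs_push. Qed.

Lemma runs_push2 a x y z : runs (Push X2 a) (x, y, z) (x, y, a :: z) 2.
Proof. exact: runs_push. Qed.

Lemma runs_pop0 a x y z : runs (Pop X0) (a :: x, y, z) (x, y, z) 1.
Proof. exact: runs_pop. Qed.

Lemma runs_pop1 a x y z : runs (Pop X1) (x, a :: y, z) (x, y, z) 1.
Proof. exact: runs_pop. Qed.

Lemma runs_pop2 a x y z : runs (Pop X2) (x, y, a :: z) (x, y, z) 1.
Proof. exact: runs_pop. Qed.

Notation "c1 ;; c2" := (Seq c1 c2) (at level 60, right associativity).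

(** Moving a word reverses it, so the word travels through [X1] and is reversed twice. Away from
    [X0] words are delimited by marks rather than by their codes. *)
Definition unstash : cmd :=
  Push X1 mark ;; move_bits X2 X1 ;; Pop X2 ;; move_bits X1 X0 ;; Pop X1.

Lemma runs_unstash u x y z :
  runs unstash (x, y, bits u ++ mark :: z) (bits u ++ x, y, z)
    (14 * size u + 6).
Proof.
apply: runs_le; first (apply: runs_seq; first exact: runs_push1).
  apply: runs_seq; first exact: runs_move21.
  apply: runs_seq; first exact: runs_pop2.
  apply: runs_seq; first exact: runs_move10.
  rewrite revK; exact: runs_pop1.
by rewrite size_rev; lia.
Qed.

Definition dup2 : cmd :=
  Push X1 mark ;; move_bits X2 X1 ;;
  While X1 is_bit (xfer2 X1 X0 X2) ;; Pop X1.

Lemma runs_dup2 u x y z :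
  runs dup2 (x, y, bits u ++ mark :: z) (bits u ++ x, y, bits u ++ mark :: z)
    (16 * size u + 5).
Proof.
apply: runs_le; first (apply: runs_seq; first exact: runs_push1).
  apply: runs_seq; first exact: runs_move21.
  apply: runs_seq; first exact: runs_move102.
  rewrite revK; exact: runs_pop1.
by rewrite size_rev; lia.
Qed.

Definition drop2 : cmd := While X2 is_bit (Pop X2) ;; Pop X2.

Lemma runs_drop2 u x y z :
  runs drop2 (x, y, bits u ++ mark :: z) (x, y, z) (3 * size u + 2).
Proof.
rewrite (_ : 3 * size u + 2 = (3 * size u).+1 + 1); last by lia.
apply: (@runs_seq _ _ _ (x, y, mark :: z)); last exact: runs_pop2.
apply: (@while_bits X2 _ 1 u (fun u v => (x, y, bits u ++ mark :: z))) => //.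
by move=> b u' v; exact: runs_pop.
Qed.

Section Values.
Variable A : encType.
Implicit Types a : A.

(** On [X0] nothing separates a value from what lies below, so the [mover] of its type has to find
    its end. *)
Definition stash : cmd :=
  Push X1 mark ;; Push X2 mark ;; mover A ;; move_bits X1 X2 ;; Pop X1.

Lemma runs_stash a x y z :
  runs stash (bits (code a) ++ x, y, z) (x, y, bits (code a) ++ mark :: z)
    (14 * size (code a) + 6).
Proof.
apply: runs_le; first (apply: runs_seq; first exact: runs_push1).
  apply: runs_seq; first exact: runs_push2.
  apply: runs_seq; first exact: moverP.
  apply: runs_seq; first exact: runs_move12.
  rewrite revK; exact: runs_pop1.
by rewrite size_rev; lia.
Qed.

Definition keep : cmd :=
  Push X1 mark ;; Push X2 mark ;; mover A ;;
  While X1 is_bit (xfer2 X1 X0 X2) ;; Pop X1.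

Lemma runs_keep a x y z :
  runs keep (bits (code a) ++ x, y, z)
    (bits (code a) ++ x, y, bits (code a) ++ mark :: z)
    (16 * size (code a) + 6).
Proof.
apply: runs_le; first (apply: runs_seq; first exact: runs_push1).
  apply: runs_seq; first exact: runs_push2.
  apply: runs_seq; first exact: moverP.
  apply: runs_seq; first exact: runs_move102.
  rewrite revK; exact: runs_pop1.
by rewrite size_rev; lia.
Qed.

Definition discard : cmd :=
  Push X1 mark ;; mover A ;; While X1 is_bit (Pop X1) ;; Pop X1.

Lemma runs_discard a x y z :
  runs discard (bits (code a) ++ x, y, z) (x, y, z) (10 * size (code a) + 4).
Proof.
apply: runs_le; first (apply: runs_seq; first exact: runs_push1).
  apply: runs_seq; first exact: moverP.
  apply: runs_seq; first exact: runs_drop1.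
  exact: runs_pop1.
by rewrite size_rev; lia.
Qed.

End Values.

Fixpoint push_bits (u : bitseq) : cmd :=
  if u is b :: u' then push_bits u' ;; Push X0 (inl b) else Skip.

Lemma runs_push_bits u x y z :
  runs (push_bits u) (x, y, z) (bits u ++ x, y, z) (2 * size u).
Proof.
elim: u => [|b u IH] /=; first exact: runs_skip.
rewrite mulnS addnC; apply: runs_seq; [exact: IH | exact: runs_push0].
Qed.

(** * Polynomial bounds *)

(** The positive base [n.+1] lets exponents be raised freely, so two bounds can be merged into
    one. *)
Definition polyb (p : nat -> nat) : Prop :=
  exists k d, forall n, p n <= k * n.+1 ^ d.

Lemma polybW p q : polyb q -> (forall n, p n <= q n) -> polyb p.
Proof. by move=> [k [d kd]] pq; exists k, d => n; exact: leq_trans (pq n) _. Qed.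

Lemma polyb_const k : polyb (fun=> k).
Proof. by exists k, 0 => n; rewrite muln1. Qed.

Lemma polyb_id : polyb (fun n => n).
Proof. by exists 1, 1 => n; rewrite mul1n expn1. Qed.

Lemma polybD p q : polyb p -> polyb q -> polyb (fun n => p n + q n).
Proof.
move=> [k1 [d1 h1]] [k2 [d2 h2]]; exists (k1 + k2), (d1 + d2) => n.
rewrite mulnDl; apply: leq_add.
  by apply: leq_trans (h1 n) _; rewrite leq_mul // leq_pexp2l // leq_addr.
by apply: leq_trans (h2 n) _; rewrite leq_mul // leq_pexp2l // leq_addl.
Qed.

Lemma polybM p q : polyb p -> polyb q -> polyb (fun n => p n * q n).
Proof.
move=> [k1 [d1 h1]] [k2 [d2 h2]]; exists (k1 * k2), (d1 + d2) => n.
by rewrite expnD mulnACA leq_mul.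
Qed.

Lemma polybX p d : polyb p -> polyb (fun n => p n ^ d).
Proof.
move=> pp; elim: d => [|d IH]; first exact: polyb_const.
apply: polybW (polybM pp IH) _ => n; by rewrite expnS.
Qed.

Lemma polybS p : polyb p -> polyb (fun n => (p n).+1).
Proof.
by move/polybD/(_ (polyb_const 1)) => h; apply: polybW h _ => n; rewrite addn1.
Qed.

(** [polyb] does not ask for monotonicity, but composition needs it; every bound is therefore
    replaced by one of this form. *)
Definition powb (k d n : nat) := k * n.+1 ^ d.

Lemma powb_mono k d m n : m <= n -> powb k d m <= powb k d n.
Proof. by move=> le_mn; rewrite leq_mul //; case: d => // d; rewrite leq_exp2r. Qed.

Lemma polyb_powb k d p : polyb p -> polyb (fun n => powb k d (p n)).
Proof. by move=> pp; apply: polybM (polyb_const k) (polybX d (polybS pp)). Qed.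

Ltac poly_tac := repeat first
  [ assumption | exact: polyb_id | exact: polyb_const | apply: polyb_powb
  | apply: polybS | apply: polybD | apply: polybM | apply: polybX ].

(** * Functions computable in polynomial time *)

Definition ptime (A B : encType) (f : A -> B) : Prop :=
  exists c p, polyb p /\ forall a x y z,
    runs c (bits (code a) ++ x, y, z) (bits (code (f a)) ++ x, y, z)
      (p (size (code a))).

(** A single monotone bound for time and output size: it dominates input size plus time, which
    bounds the output by [runs_size] on otherwise empty stacks. *)
Lemma ptimeE (A B : encType) (f : A -> B) : ptime f ->
  exists c k d,
    (forall a x y z, runs c (bits (code a) ++ x, y, z)
       (bits (code (f a)) ++ x, y, z) (powb k d (size (code a)))) /\
    (forall a, size (code (f a)) <= powb k d (size (code a))).
Proof.
move=> [c [p [pp cP]]].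
have [k [d kd]] := polybD polyb_id pp; exists c, k, d; split=> [a x y z|a].
  by apply: runs_le (cP a x y z) _; apply: leq_trans (kd _); exact: leq_addl.
have /runs_size := cP a [::] [::] [::].
rewrite /store_size /= !cats0 !size_bits !addn0 => h.
exact: leq_trans h (kd _).
Qed.

Lemma eq_ptime (A B : encType) (f g : A -> B) : f =1 g -> ptime f -> ptime g.
Proof.
move=> fg [c [p [pp cP]]]; exists c, p; split=> // a x y z.
by rewrite -fg.
Qed.

(* Two types may share their codes; a recoding then costs nothing. *)
Lemma pt_recode (A B : encType) (f : A -> B) :
  (forall a, code (f a) = code a) -> ptime f.
Proof.
move=> fE; exists Skip, (fun=> 0); split=> [|a x y z]; first exact: polyb_const.
by rewrite fE; exact: runs_skip.
Qed.

Lemma pt_id (A : encType) : ptime (fun a : A => a).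
Proof. exact: pt_recode. Qed.

Lemma pt_comp (A B C : encType) (g : B -> C) (f : A -> B) :
  ptime g -> ptime f -> ptime (fun a => g (f a)).
Proof.
move=> /ptimeE[cg [kg [dg [gP _]]]] /ptimeE[cf [kf [df [fP szf]]]].
exists (cf ;; cg), (fun n => powb kf df n + powb kg dg (powb kf df n)).
split=> [|a x y z]; first by poly_tac.
apply: runs_seq; first exact: fP.
by apply: runs_le (gP _ _ _ _) _; exact: powb_mono.
Qed.

Lemma pt_const (A B : encType) (b : B) : ptime (fun _ : A => b).
Proof.
exists (discard A ;; push_bits (code b)), (fun n => 10 * n + 4 + 2 * size (code b)).
split=> [|a x y z]; first by poly_tac.
by apply: runs_seq; [exact: runs_discard|exact: runs_push_bits].
Qed.

Lemma code_pair (A B : encType) (a : A) (b : B) : code (a, b) = code a ++ code b.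
Proof. by []. Qed.

Lemma size_code_pair (A B : encType) (a : A) (b : B) :
  size (code (a, b)) = size (code a) + size (code b).
Proof. by rewrite code_pair size_cat. Qed.

Lemma code_bool (b : bool) : code b = [:: b]. Proof. by []. Qed.

(** [g] is computed first because the first component of a pair must end on top. *)
Lemma pt_pair (A B C : encType) (f : A -> B) (g : A -> C) :
  ptime f -> ptime g -> ptime (fun a => (f a, g a)).
Proof.
move=> /ptimeE[cf [kf [df [fP szf]]]] /ptimeE[cg [kg [dg [gP szg]]]].
exists (keep A ;; cg ;; unstash ;; cf),
  (fun n => (16 * n + 6) + (powb kg dg n + ((14 * n + 6) + powb kf df n))).
split=> [|a x y z]; first by poly_tac.
apply: runs_seq; first exact: runs_keep.
apply: runs_seq; first exact: gP.
apply: runs_seq; first exact: runs_unstash.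
by rewrite code_pair bits_cat -catA; exact: fP.
Qed.

Lemma pt_fst (A B : encType) : ptime (fun x : A * B => x.1).
Proof.
exists (stash A ;; discard B ;; unstash),
  (fun n => (14 * n + 6) + ((10 * n + 4) + (14 * n + 6))).
split=> [|[a b] x y z]; first by poly_tac.
rewrite size_code_pair code_pair bits_cat -catA.
apply: runs_le; first apply: runs_seq; first exact: runs_stash.
  apply: runs_seq; first exact: runs_discard.
  exact: runs_unstash.
lia.
Qed.

Lemma pt_snd (A B : encType) : ptime (fun x : A * B => x.2).
Proof.
exists (discard A), (fun n => 10 * n + 4).
split=> [|[a b] x y z]; first by poly_tac.
rewrite size_code_pair code_pair bits_cat -catA.
apply: runs_le; first exact: runs_discard.
lia.
Qed.

Lemma pt_if (A B : encType) (b : A -> bool) (f g : A -> B) :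
  ptime b -> ptime f -> ptime g -> ptime (fun a => if b a then f a else g a).
Proof.
move=> bP /ptimeE[cf [kf [df [fP szf]]]] /ptimeE[cg [kg [dg [gP szg]]]].
apply: (@pt_comp _ (bool * A)%type _
  (fun x => if x.1 then f x.2 else g x.2) (fun a => (b a, a))); last first.
  exact: pt_pair bP (pt_id _).
exists (If X0 is_true_bit (Pop X0 ;; cf) (Pop X0 ;; cg)),
  (fun n => (1 + (powb kf df n + powb kg dg n)).+2).
split=> [|[b0 a] x y z]; first by poly_tac.
rewrite size_code_pair code_pair code_bool.
apply: runs_if; case: b0; apply: runs_seq; try exact: runs_pop0.
  apply: runs_le (fP _ _ _ _) _; apply: leq_trans (leq_addr _ _).
  exact/powb_mono/leq_addl.
apply: runs_le (gP _ _ _ _) _; apply: leq_trans (leq_addl _ _).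
exact/powb_mono/leq_addl.
Qed.

Lemma code_cons (A : encType) (a : A) l : code (a :: l) = true :: code a ++ code l.
Proof. exact: enc_seq_cons. Qed.

Lemma size_code_cons (A : encType) (a : A) l :
  size (code (a :: l)) = (size (code a) + size (code l)).+1.
Proof. by rewrite code_cons /= size_cat. Qed.

Lemma size_code_nat (n : nat) : size (code n) = n.+1.
Proof. by rewrite [code n]/(enc_nat n) size_rcons size_nseq. Qed.

Lemma size_code_bool (b : bool) : size (code b) = 1.
Proof. by []. Qed.

Lemma pt_cons (A B : encType) (f : A -> B) (g : A -> seq B) :
  ptime f -> ptime g -> ptime (fun a => f a :: g a).
Proof.
move=> fP gP; apply: (@pt_comp _ (B * seq B)%type _
  (fun x => x.1 :: x.2) (fun a => (f a, g a))); last exact: pt_pair fP gP.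
exists (Push X0 (inl true)), (fun=> 2).
split=> [|[b l] x y z]; first by poly_tac.
rewrite code_cons; exact: runs_push0.
Qed.

Lemma pt_succ (A : encType) (f : A -> nat) :
  ptime f -> ptime (fun a => (f a).+1).
Proof.
apply: (@pt_comp _ _ _ succn f).
exists (Push X0 (inl true)), (fun=> 2).
split=> [|n x y z]; first by poly_tac.
exact: runs_push0.
Qed.

(** The leading bit of a list code decides the case. Once it is popped, what remains of a nonempty
    list paired with [a] is literally the code of the nested pair of head, tail and [a]. *)
Lemma pt_match (A B C : encType) (l : A -> seq B) (f : A -> B -> seq B -> C)
    (g : A -> C) :
  ptime l -> ptime (fun x : B * (seq B * A) => f x.2.2 x.1 x.2.1) -> ptime g ->
  ptime (fun a => if l a is b :: l' then f a b l' else g a).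
Proof.
move=> lP /ptimeE[cf [kf [df [fP szf]]]] /ptimeE[cg [kg [dg [gP szg]]]].
apply: (@pt_comp _ (seq B * A)%type _
  (fun x => if x.1 is b :: l' then f x.2 b l' else g x.2) (fun a => (l a, a)));
  last exact: pt_pair lP (pt_id _).
exists (If X0 is_true_bit (Pop X0 ;; cf) (Pop X0 ;; cg)),
  (fun n => (1 + (powb kf df n + powb kg dg n)).+2).
split=> [|[[|b l'] a] x y z]; first by poly_tac.
  have -> : code ([::] : seq B, a) = false :: code a by [].
  apply: runs_if; apply: runs_seq; first exact: runs_pop0.
  apply: runs_le (gP _ _ _ _) _.
  by apply: leq_trans (leq_addl _ _); exact: powb_mono.
have -> : code (b :: l', a) = true :: code (b, (l', a)).
  by rewrite !code_pair code_cons cat_cons -catA.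
apply: runs_if; apply: runs_seq; first exact: runs_pop0.
apply: runs_le; first exact: (fP (b, (l', a))).
by apply: leq_trans (leq_addr _ _); exact: powb_mono.
Qed.

(* During the loop, the list lies on top of [X0], and the state followed by the
   environment on top of [X2]. *)
Lemma pt_foldl (E S A : encType) (f : E -> S -> A -> S) (q : nat -> nat) :
  ptime (fun x : E * (S * A) => f x.1 x.2.1 x.2.2) -> polyb q ->
  (forall e s l1 l2, size (code (foldl (f e) s l1)) <=
                     q (size (code (e, (s, l1 ++ l2))))) ->
  ptime (fun x : E * (S * seq A) => foldl (f x.1) x.2.1 x.2.2).
Proof.
move=> /ptimeE[cf [k [d [fP _]]]] qP qf.
pose body := Pop X0 ;; unstash ;; dup2 ;; cf ;; stash S.
(* The time of one round: the state is moved out and back at 14 steps per bit each, the environment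
   is copied at 16 per bit, and the constants of the body add up to 18, leaving 2 for the loop. *)
pose T n := (30 * q n + 16 * n + powb k d (n + n + q n) + 20).
exists (stash E ;; stash S ;; While X0 is_true_bit body ;; Pop X0 ;;
        unstash ;; drop2).
exists (fun n => 14 * n + 6 + (14 * n + 6 +
  ((T n * n).+1 + (1 + ((14 * q n + 6) + (3 * n + 2)))))).
split=> [|[e [s l]] x y z]; first by rewrite /T; poly_tac.
set n := size (code (e, (s, l))).
rewrite !code_pair !bits_cat -!catA.
have [se ss sl] : [/\ size (code e) <= n, size (code s) <= n & size (code l) <= n].
  by rewrite /n !size_code_pair; split; lia.
apply: runs_seq; first by apply: runs_le (runs_stash _ _ _ _) _; lia.
apply: runs_seq; first by apply: runs_le (runs_stash _ _ _ _) _; lia.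
have qs l1 l2 : l = l1 ++ l2 -> size (code (foldl (f e) s l1)) <= q n.
  by move=> ll; have := qf e s l1 l2; rewrite -ll.
apply: (@runs_seq _ _ _ (inl false :: x, y,
   bits (code (foldl (f e) s l)) ++ mark :: bits (code e) ++ mark :: z));
  last first.
  apply: runs_seq; first exact: runs_pop0.
  apply: runs_seq.
    apply: runs_le (runs_unstash _ _ _ _) _.
    by have := qs l [::]; rewrite cats0 => /(_ erefl); lia.
  by apply: runs_le (runs_drop2 _ _ _ _) _; lia.
apply: (@runs_le _ _ _ (T n * size (code l)).+1); last first.
  by rewrite ltnS leq_mul.
(* [n] is frozen at the size of the whole input, so that [q n] bounds all intermediate states while
   the induction shortens [l] and changes [s]. *)
clearbody n; clear ss; elim: l s sl qs => [|b l IH] s sl qs.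
  by apply: runs_le; first exact: runs_done.
have s0 : size (code s) <= q n := qs [::] _ erefl.
have s1 : size (code (f e s b)) <= q n := qs [:: b] _ erefl.
move: sl; rewrite size_code_cons code_cons => sl.
have Tn : 20 <= T n by rewrite /T; lia.
apply: (@runs_le _ _ _ ((T n - 2) + (T n * size (code l)).+1).+2); last first.
  by rewrite mulnS mulnDr; lia.
rewrite bits_cons bits_cat cat_cons -catA.
apply: (runs_while (s1 := (bits (code l) ++ x, y,
   bits (code (f e s b)) ++ mark :: bits (code e) ++ mark :: z))); first by [].
  2: { apply: IH; first by lia.
  by move=> l1 l2 el; apply: (qs (b :: l1) l2); rewrite el. }
apply: runs_le.
  apply: runs_seq; first exact: runs_pop0.
  apply: runs_seq; first exact: runs_unstash.
  apply: runs_seq; first exact: runs_dup2.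
  apply: runs_seq; last exact: runs_stash.
  have := fP (e, (s, b)) (bits (code l) ++ x) y (bits (code e) ++ mark :: z).
  by rewrite [in X in X -> _](_ : code (e, (s, b)) = code e ++ code s ++ code b)
     // !bits_cat -!catA; exact.
have : powb k d (size (code e ++ code s ++ code b)) <= powb k d (n + n + q n).
  by apply: powb_mono; rewrite !size_cat; lia.
by rewrite /T /=; lia.
Qed.

Lemma pt_fold (A E S B : encType) (f : E -> S -> B -> S) (q : nat -> nat)
    (e : A -> E) (s : A -> S) (l : A -> seq B) :
  ptime e -> ptime s -> ptime l ->
  ptime (fun x : E * (S * B) => f x.1 x.2.1 x.2.2) -> polyb q ->
  (forall e s l1 l2, size (code (foldl (f e) s l1)) <=
                     q (size (code (e, (s, l1 ++ l2))))) ->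
  ptime (fun a => foldl (f (e a)) (s a) (l a)).
Proof.
move=> eP sP lP fP qP qf.
exact: (@pt_comp _ (E * (S * seq B))%type S
  (fun x => foldl (f x.1) x.2.1 x.2.2) (fun a => (e a, (s a, l a))))
  (pt_foldl fP qP qf) (pt_pair eP (pt_pair sP lP)).
Qed.

Lemma pt_proj1 (A B C : encType) (f : A -> B * C) :
  ptime f -> ptime (fun a => (f a).1).
Proof. exact: (pt_comp (pt_fst B C)). Qed.

Lemma pt_proj2 (A B C : encType) (f : A -> B * C) :
  ptime f -> ptime (fun a => (f a).2).
Proof. exact: (pt_comp (pt_snd B C)). Qed.

Lemma pt_negb (A : encType) (b : A -> bool) : ptime b -> ptime (fun a => ~~ b a).
Proof.
move=> bP; apply: (@eq_ptime _ _ (fun a => if b a then false else true)).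
  by move=> a; case: (b a).
by apply: pt_if => //; exact: pt_const.
Qed.

Lemma pt_andb (A : encType) (b c : A -> bool) :
  ptime b -> ptime c -> ptime (fun a => b a && c a).
Proof. by move=> bP cP; apply: (pt_if bP cP); exact: pt_const. Qed.

Lemma pt_orb (A : encType) (b c : A -> bool) :
  ptime b -> ptime c -> ptime (fun a => b a || c a).
Proof. by move=> bP cP; apply: (pt_if bP) => //; exact: pt_const. Qed.

Lemma pt_eqb (A : encType) (b c : A -> bool) :
  ptime b -> ptime c -> ptime (fun a => b a == c a).
Proof.
move=> bP cP; apply: (@eq_ptime _ _ (fun a => if b a then c a else ~~ c a)).
  by move=> a; case: (b a) (c a) => [] [].
by apply: pt_if => //; exact: pt_negb.
Qed.

(** * List operations as bounded folds *)

Lemma size_code_nil (A : encType) : size (code ([::] : seq A)) = 1.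
Proof. by []. Qed.

Lemma size_code_cat (A : encType) (l1 l2 : seq A) :
  (size (code (l1 ++ l2))).+1 = size (code l1) + size (code l2).
Proof.
elim: l1 => [|a l1 IH]; first by rewrite add1n.
by rewrite cat_cons !size_code_cons -addnS IH addSn addnA.
Qed.

Lemma size_code_rev (A : encType) (l : seq A) :
  size (code (rev l)) = size (code l).
Proof.
elim: l => // a l IH; apply: succn_inj.
rewrite rev_cons -cats1 size_code_cat IH !size_code_cons size_code_nil.
by rewrite addn1 addnS addnC.
Qed.

Lemma foldl_cons (A : Type) (s l : seq A) :
  foldl (fun s x => x :: s) s l = catrev l s.
Proof. by elim: l s => //= a l IH s. Qed.

Lemma pt_catrev (A B : encType) (f g : A -> seq B) :
  ptime f -> ptime g -> ptime (fun a => catrev (f a) (g a)).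
Proof.
move=> fP gP.
apply: (@eq_ptime _ _ (fun a => foldl (fun s x => x :: s) (g a) (f a))).
  by move=> a; exact: foldl_cons.
apply: (@pt_fold _ unit _ _ (fun _ s x => x :: s) id (fun=> tt)) => //.
- exact: pt_const.
- apply: pt_cons; first exact/pt_proj2/pt_proj2/pt_id.
  exact/pt_proj1/pt_proj2/pt_id.
- exact: polyb_id.
move=> u s l1 l2; rewrite foldl_cons catrevE.
have := size_code_cat (rev l1) s; have := size_code_cat l1 l2.
rewrite size_code_rev !size_code_pair; lia.
Qed.

Lemma pt_rev (A B : encType) (f : A -> seq B) :
  ptime f -> ptime (fun a => rev (f a)).
Proof. by move=> fP; apply: pt_catrev => //; exact: pt_const. Qed.

Lemma pt_cat (A B : encType) (f g : A -> seq B) :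
  ptime f -> ptime g -> ptime (fun a => f a ++ g a).
Proof.
move=> fP gP; apply: (@eq_ptime _ _ (fun a => catrev (rev (f a)) (g a))).
  by move=> a; rewrite catrevE revK.
exact/pt_catrev/gP/pt_rev.
Qed.

Lemma foldl_catrev (A B : Type) (f : A -> seq B) l s :
  foldl (fun s x => catrev (f x) s) s l = rev (flatten [seq f x | x <- l]) ++ s.
Proof. by elim: l s => //= a l IH s; rewrite IH catrevE rev_cat catA. Qed.

Lemma size_code_flatten_map (A B : encType) (f : A -> seq B) (n : nat)
    (l : seq A) :
  (forall a, size (code a) <= size (code l) -> size (code (f a)) <= n) ->
  size (code (flatten [seq f x | x <- l])) <= size l * n + 1.
Proof.
elim: l => [|a l IH] fn //.
rewrite map_cons [flatten _]/(f a ++ flatten [seq f x | x <- l]).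
have -> : size (a :: l) * n = n + size l * n by [].
rewrite -ltnS size_code_cat; have := fn a.
rewrite size_code_cons ltnW ?ltnS ?leq_addr // => /(_ isT).
have : size (code (flatten [seq f x | x <- l])) <= size l * n + 1.
  apply: IH => b lb; apply: fn; rewrite size_code_cons.
  by apply: leq_trans lb _; rewrite -addSn leq_addl.
lia.
Qed.

Lemma size_le_code (A : encType) (l : seq A) : size l <= size (code l).
Proof. by elim: l => // a l IH; rewrite size_code_cons /=; lia. Qed.

Lemma pt_flatmap (A B C : encType) (l : A -> seq B) (f : A -> B -> seq C) :
  ptime l -> ptime (fun x : A * B => f x.1 x.2) ->
  ptime (fun a => flatten [seq f a b | b <- l a]).
Proof.
move=> lP fP.
apply: (@eq_ptime _ _
  (fun a => rev (foldl (fun s b => catrev (f a b) s) [::] (l a)))).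
  by move=> a; rewrite foldl_catrev cats0 revK.
apply: pt_rev; have [_ [k [d [_ szf]]]] := ptimeE fP.
apply: (@pt_fold A A _ _ (fun a s b => catrev (f a b) s)
          (fun n => n * powb k d (n + n) + n) id (fun=> [::])) => //.
- exact: pt_id.
- exact: pt_const.
- apply: pt_catrev; last exact/pt_proj1/pt_proj2/pt_id.
  apply: (@pt_comp _ (A * B)%type _ (fun x => f x.1 x.2) (fun x => (x.1, x.2.2))) => //.
  by apply: pt_pair; [exact/pt_proj1/pt_id | exact/pt_proj2/pt_proj2/pt_id].
- by poly_tac.
move=> a s l1 l2; rewrite foldl_catrev -ltnS size_code_cat size_code_rev.
rewrite !size_code_pair; set n := size (code (l1 ++ l2)).
have s1 : size (code l1) <= n.
  have l20 : 0 < size (code l2) by case: (l2) => // b l; rewrite size_code_cons.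
  by have := size_code_cat l1 l2; rewrite /n; lia.
have : size (code (flatten [seq f a x | x <- l1])) <=
    size l1 * powb k d (size (code a) + n) + 1.
  apply: size_code_flatten_map => b sb; apply: leq_trans (szf (a, b)) _.
  by apply: powb_mono; rewrite size_code_pair leq_add2l (leq_trans sb).
set N := size (code a) + (size (code s) + n).
have : size l1 * powb k d (size (code a) + n) <= N * powb k d (N + N).
  apply: leq_mul; first by have := size_le_code l1; rewrite /N; lia.
  by apply: powb_mono; rewrite /N; lia.
by rewrite /N; lia.
Qed.

Lemma pt_map (A B C : encType) (l : A -> seq B) (f : A -> B -> C) :
  ptime l -> ptime (fun x : A * B => f x.1 x.2) ->
  ptime (fun a => [seq f a b | b <- l a]).
Proof.
move=> lP fP; apply: (@eq_ptime _ _ (fun a => flatten [seq [:: f a b] | b <- l a])).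
  by move=> a; exact: flatten_map1.
by apply: pt_flatmap => //; apply: pt_cons => //; exact: pt_const.
Qed.

Lemma pt_filter (A B : encType) (l : A -> seq B) (p : A -> B -> bool) :
  ptime l -> ptime (fun x : A * B => p x.1 x.2) ->
  ptime (fun a => [seq b <- l a | p a b]).
Proof.
move=> lP fP; apply: (@eq_ptime _ _
  (fun a => flatten [seq (if p a b then [:: b] else [::]) | b <- l a])).
  by move=> a; elim: (l a) => //= b s ->; case: ifP.
apply: pt_flatmap => //; apply: pt_if => //; last exact: pt_const.
by apply: pt_cons; [exact/pt_proj2/pt_id | exact: pt_const].
Qed.

Lemma pt_has (A B : encType) (l : A -> seq B) (p : A -> B -> bool) :
  ptime l -> ptime (fun x : A * B => p x.1 x.2) ->
  ptime (fun a => has (p a) (l a)).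
Proof.
move=> lP fP; apply: (@eq_ptime _ _
  (fun a => foldl (fun s b => s || p a b) false (l a))).
  move=> a; rewrite -[RHS]orFb; elim: (l a) false => [|b s IH] c /=.
    by rewrite orbF.
  by rewrite IH orbA.
apply: (@pt_fold A A _ _ (fun a s b => s || p a b) (fun=> 1) id (fun=> false)) => //.
- exact: pt_id.
- exact: pt_const.
- apply: pt_orb; first exact/pt_proj1/pt_proj2/pt_id.
  apply: (@pt_comp _ (A * B)%type _ (fun x => p x.1 x.2) (fun x => (x.1, x.2.2))) => //.
  by apply: pt_pair; [exact/pt_proj1/pt_id | exact/pt_proj2/pt_proj2/pt_id].
- exact: polyb_const.
Qed.

(** * Unary arithmetic and bounded iteration *)

Lemma pt_nseq (A : encType) (f : A -> nat) :
  ptime f -> ptime (fun a => nseq (f a) tt).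
Proof.
apply: (@pt_comp _ nat _ (fun n => nseq n tt)); apply: pt_recode => n.
exact: esym (enc_nat_seq n).
Qed.

Lemma pt_size_units (A : encType) (f : A -> seq unit) :
  ptime f -> ptime (fun a => size (f a)).
Proof.
apply: (@pt_comp _ (seq unit) nat size); apply: pt_recode => l.
rewrite [LHS]enc_nat_seq; congr enc_seq.
by elim: l => //= [[] l] ->.
Qed.

Lemma pt_size (A B : encType) (f : A -> seq B) :
  ptime f -> ptime (fun a => size (f a)).
Proof.
move=> fP; apply: (@eq_ptime _ _ (fun a => size [seq tt | _ <- f a])).
  by move=> a; rewrite size_map.
by apply: pt_size_units; apply: pt_map => //; exact: pt_const.
Qed.

Lemma pt_addn (A : encType) (f g : A -> nat) :
  ptime f -> ptime g -> ptime (fun a => f a + g a).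
Proof.
move=> fP gP; apply: (@eq_ptime _ _ (fun a => size (nseq (f a) tt ++ nseq (g a) tt))).
  by move=> a; rewrite size_cat !size_nseq.
by apply: pt_size; apply: pt_cat; exact: pt_nseq.
Qed.

Lemma pt_muln (A : encType) (f g : A -> nat) :
  ptime f -> ptime g -> ptime (fun a => f a * g a).
Proof.
move=> fP gP; apply: (@eq_ptime _ _
  (fun a => size (flatten [seq nseq (g a) tt | _ <- nseq (f a) tt]))).
  by move=> a; elim: (f a) => //= n; rewrite size_cat size_nseq => ->.
apply: pt_size; apply: pt_flatmap; first exact: pt_nseq.
exact/pt_nseq/(pt_comp gP)/pt_proj1/pt_id.
Qed.

Lemma foldl_iter (T : Type) (f : T -> T) x n :
  foldl (fun s _ => f s) x (nseq n tt) = iter n f x.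
Proof. by elim: n x => //= n IH x; rewrite IH -iterSr. Qed.

Lemma foldl_units (T : Type) (f : T -> T) x l :
  foldl (fun s (_ : unit) => f s) x l = iter (size l) f x.
Proof. by elim: l x => //= u l IH x; rewrite IH -iterSr. Qed.

Lemma pt_iter (A E S : encType) (f : E -> S -> S) (q : nat -> nat)
    (e : A -> E) (s : A -> S) (n : A -> nat) :
  ptime e -> ptime s -> ptime n ->
  ptime (fun x : E * S => f x.1 x.2) -> polyb q ->
  (forall e s n, size (code (iter n (f e) s)) <= q (size (code (e, (s, n))))) ->
  ptime (fun a => iter (n a) (f (e a)) (s a)).
Proof.
move=> eP sP nP fP qP qf; apply: (@eq_ptime _ _
  (fun a => foldl (fun s _ => f (e a) s) (s a) (nseq (n a) tt))).
  by move=> a; exact: foldl_iter.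
have [k [d qkd]] := qP.
apply: (@pt_fold A E S _ (fun e s (_ : unit) => f e s) (powb k d)) => //.
- exact: pt_nseq.
- apply: (@pt_comp _ (E * S)%type _ (fun x => f x.1 x.2) (fun x => (x.1, x.2.1))) => //.
  by apply: pt_pair; [exact/pt_proj1/pt_id | exact/pt_proj1/pt_proj2/pt_id].
- by exists k, d.
move=> e' s' l1 l2; rewrite foldl_units.
apply: leq_trans (qf _ _ _) _; apply: leq_trans (qkd _) _; apply: powb_mono.
rewrite !size_code_pair !leq_add2l size_code_nat.
apply: (@leq_ltn_trans (size (l1 ++ l2))); first by rewrite size_cat leq_addr.
by elim: (l1 ++ l2) => // u l IH; rewrite size_code_cons ltnS.
Qed.

Lemma pt_pred (A : encType) (f : A -> nat) :
  ptime f -> ptime (fun a => (f a).-1).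
Proof.
move=> fP; apply: (@eq_ptime _ _
  (fun a => if nseq (f a) tt is _ :: l then size l else 0)).
  by move=> a; case: (f a) => //= n; rewrite size_nseq.
apply: (@pt_match _ _ _ _ (fun _ _ l => size l) (fun=> 0)).
- exact: pt_nseq.
- exact/pt_size/pt_proj1/pt_proj2/pt_id.
- exact: pt_const.
Qed.

Lemma pt_eqn0 (A : encType) (f : A -> nat) :
  ptime f -> ptime (fun a => f a == 0).
Proof.
move=> fP; apply: (@eq_ptime _ _
  (fun a => if nseq (f a) tt is _ :: l then false else true)).
  by move=> a; case: (f a).
by apply: (@pt_match _ _ _ _ (fun _ _ l => false) (fun=> true));
  [exact: pt_nseq | exact: pt_const..].
Qed.

Lemma pt_subn (A : encType) (f g : A -> nat) :
  ptime f -> ptime g -> ptime (fun a => f a - g a).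
Proof.
have iter_pred n m : iter n predn m = m - n.
  by elim: n => [|n IH]; rewrite ?subn0 //= IH subnS.
move=> fP gP; apply: (@eq_ptime _ _ (fun a => iter (g a) predn (f a))).
  by move=> a; exact: iter_pred.
apply: (@pt_iter A unit nat (fun _ => predn) id (fun=> tt)) => //.
- exact: pt_const.
- exact/pt_pred/pt_proj2/pt_id.
- exact: polyb_id.
by move=> u s n; rewrite iter_pred !size_code_pair !size_code_nat; lia.
Qed.

Lemma pt_eqn (A : encType) (f g : A -> nat) :
  ptime f -> ptime g -> ptime (fun a => f a == g a).
Proof.
move=> fP gP; apply: (@eq_ptime _ _ (fun a => f a - g a + (g a - f a) == 0)).
  by move=> a; apply/eqP/eqP; lia.
by apply/pt_eqn0/pt_addn; exact: pt_subn.
Qed.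

Lemma pt_eqnil (A B : encType) (f : A -> seq B) :
  ptime f -> ptime (fun a => nilp (f a)).
Proof. by move=> fP; apply/pt_eqn0/pt_size. Qed.

(** The length of the list built so far serves as the counter, and the list comes out reversed. *)
Lemma pt_iota (A : encType) (f : A -> nat) :
  ptime f -> ptime (fun a => iota 0 (f a)).
Proof.
pose F (s : seq nat) := size s :: s.
have iterF n : iter n F [::] = rev (iota 0 n).
  elim: n => // n IH.
  by rewrite iterS IH /F size_rev size_iota -addn1 iotaD rev_cat.
have size_iterF s n : size (iter n F s) = size s + n.
  by elim: n => [|n IH]; rewrite ?addn0 //= IH addnS.
(* The bound is needed from an arbitrary list, since [pt_iter] quantifies over all starting
   states. *)
have size_code_iterF (s : seq nat) n :
    size (code (iter n F s)) <= size (code s) + n * (size s + n + 2).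
  elim: n => [|n IH]; first by rewrite mul0n addn0.
  by rewrite iterS size_code_cons size_code_nat size_iterF; nia.
move=> fP; apply: (@eq_ptime _ _ (fun a => rev (iter (f a) F [::]))).
  by move=> a; rewrite iterF revK.
apply: pt_rev; apply: (@pt_iter A unit _ (fun=> F) (fun n => n + n * (n + n))
  (fun=> tt) (fun=> [::])) => //.
- exact: pt_const.
- exact: pt_const.
- by apply: pt_cons; [apply: pt_size|]; exact/pt_proj2/pt_id.
- by poly_tac.
move=> u s n; rewrite !size_code_pair !size_code_nat.
apply: leq_trans (size_code_iterF s n) _.
have := @size_le_code nat_encType s.
by move: (size (code s)) (size (code u)) (@size nat s) => c d m; nia.
Qed.

Lemma pt_behead (A B : encType) (f : A -> seq B) :
  ptime f -> ptime (fun a => behead (f a)).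
Proof.
move=> fP; apply: (@eq_ptime _ _ (fun a => if f a is _ :: l then l else [::])).
  by move=> a; case: (f a).
apply: (@pt_match _ _ _ _ (fun _ _ l => l) (fun=> [::])) => //.
  exact/pt_proj1/pt_proj2/pt_id.
exact: pt_const.
Qed.

Lemma pt_head (A B : encType) (b : B) (f : A -> seq B) :
  ptime f -> ptime (fun a => head b (f a)).
Proof.
move=> fP; apply: (@eq_ptime _ _ (fun a => if f a is c :: _ then c else b)).
  by move=> a; case: (f a).
apply: (@pt_match _ _ _ _ (fun _ c _ => c) (fun=> b)) => //.
  exact/pt_proj1/pt_id.
exact: pt_const.
Qed.

Lemma size_code_behead (A : encType) (l : seq A) :
  size (code (behead l)) <= size (code l).
Proof.
case: l => [|a l]; first by rewrite size_code_nil.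
by rewrite size_code_cons; apply/leqW/leq_addl.
Qed.

Lemma pt_nth (A B : encType) (b : B) (l : A -> seq B) (i : A -> nat) :
  ptime l -> ptime i -> ptime (fun a => nth b (l a) (i a)).
Proof.
move=> lP iP.
have iterE n (s : seq B) : head b (iter n behead s) = nth b s n.
  by elim: n s => [|n IH] [|c s] //; rewrite iterSr IH ?nth_nil.
apply: (@eq_ptime A B (fun a => head b (iter (i a) behead (l a)))) => [a|].
  exact: iterE.
apply: pt_head.
apply: (@pt_iter A unit _ (fun=> behead) id (fun=> tt)) => //.
- exact: pt_const.
- exact/pt_behead/pt_proj2/pt_id.
- exact: polyb_id.
move=> u s n; rewrite !size_code_pair.
apply: leq_trans (leq_trans (leq_addr _ _) (leq_addl _ _)).
by elim: n => // n IH; apply: leq_trans IH; exact: size_code_behead.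
Qed.

(** * From typed functions to Turing machines *)

(** This is the shape required by [polytime]: [n.+1 <= 2 * n] for positive [n], and the additive
    term covers [n = 0]. *)
Lemma powb_bound k d n : powb k d n <= (k * 2 ^ d) * n ^ d + k * 2 ^ d.
Proof.
rewrite /powb; case: n => [|n].
  by rewrite exp1n; nia.
have : n.+2 ^ d <= (2 * n.+1) ^ d by case: d => // d; rewrite leq_exp2r //; lia.
by rewrite expnMn; nia.
Qed.

Lemma ptime_polytime (X : Type) (D : X -> Prop) (A B : encType) (f : A -> B)
    (a : X -> A) (b : X -> B) inp out :
  ptime f -> (forall x, f (a x) = b x) ->
  (forall x, inp x = code (a x)) -> (forall x, out x = code (b x)) ->
  polytime D inp out.
Proof.
move=> /ptimeE[c [k [d [cP _]]]] fab inpE outE.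
exists (stack_machine (compile 0 c)), (k * 2 ^ d), d => x _.
have [t le_t rc] := cP (a x) [::] [::] [::].
rewrite inpE outE -fab; apply: run_outputs_within (leq_trans le_t (powb_bound _ _ _)).
by rewrite !cats0 in rc; exact: rc.
Qed.

(* The code of a list of bits keeps a flag [true] before each bit; these two
   programs convert between such codes and bare bit strings delimited by the
   end of the tape. *)
Definition frame_bits : cmd :=
  Push X2 mark ;; While X0 is_bit (xfer X0 X2) ;; Push X0 (inl false) ;;
  While X2 is_bit (xfer X2 X0 ;; Push X0 (inl true)) ;; Pop X2.

Definition unframe_bits : cmd :=
  Push X1 mark ;;
  While X0 is_true_bit (Pop X0 ;; xfer X0 X1) ;; Pop X0 ;;
  move_bits X1 X0 ;; Pop X1.

Lemma size_code_bits (u : seq bool) : size (code u) = (2 * size u).+1.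
Proof.
elim: u => // b u IH; rewrite size_code_cons IH size_code_bool.
by rewrite -[RHS]/(2 * (size u).+1).+1 mulnS add1n add2n.
Qed.

Lemma runs_frame_bits (u : bitseq) y z :
  runs frame_bits (bits u, y, z) (bits (code u), y, z) (16 * size u + 7).
Proof.
apply: runs_le; first apply: runs_seq; first exact: runs_push2.
  apply: runs_seq.
    apply: (@while_bits X0 _ 5 u (fun u v => (bits u, y, bits v ++ mark :: z))) => //.
    by move=> b u' v; exact: runs_xfer02.
  apply: runs_seq; first exact: runs_push0.
  apply: (@runs_seq _ _ _ (bits (code u), y, mark :: z)); last exact: runs_pop2.
  rewrite -{2}[u]revK.
  apply: (@while_bits X2 _ 7 (rev u)
    (fun u v => (bits (code v), y, bits u ++ mark :: z))) => //.
  move=> b u' v; rewrite code_cons; apply: (@runs_seq _ _ _ _ _ 5 2).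
    have := @runs_xfer X2 X0
      (bits (code v), y, inl b :: bits u' ++ mark :: z) b _ erefl.
    exact.
  exact: runs_push0.
by rewrite size_rev; lia.
Qed.

Lemma runs_unframe_bits (u : bitseq) x y z :
  runs unframe_bits (bits (code u) ++ x, y, z) (bits u ++ x, y, z)
    (15 * size u + 8).
Proof.
apply: runs_le; first apply: runs_seq; first exact: runs_push1.
  apply: (@runs_seq _ _ _ (inl false :: x, bits (rev u) ++ mark :: y, z) _
    (8 * size u).+1).
    rewrite /rev -[mark :: y in X in runs _ X]/(bits [::] ++ mark :: y).
    elim: u [::] => [|b u IH] v; first exact: runs_done.
    apply: (@runs_le _ _ _ ((1 + 5) + (8 * size u).+1).+2); last by rewrite /=; lia.
    rewrite code_cons; apply: runs_while; [by []| |exact: (IH (b :: v))].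
    by apply: runs_seq; [exact: runs_pop0|exact: runs_xfer01].
  apply: runs_seq; first exact: runs_pop0.
  apply: runs_seq; first exact: runs_move10.
  rewrite revK; exact: runs_pop1.
by rewrite size_rev; lia.
Qed.

(** Solutions are bare bit strings ended by the end of the tape. The instance is stashed first, so
    that [frame_bits] finds nothing but the solution on [X0]. *)
Lemma ptime_polytime_bits (X : Type) (D : X -> Prop) (A : encType)
    (f : A * seq bool -> seq bool) (a : X -> A) (inp out u : X -> bitseq) :
  ptime f -> (forall x, D x -> f (a x, u x) = out x) ->
  (forall x, inp x = code (a x) ++ u x) ->
  polytime D inp out.
Proof.
move=> /ptimeE[c [k [d [cP szf]]]] fab inpE.
pose p n := 14 * n + 6 + (16 * n + 7 + (14 * n + 6 +
  (powb k d (n + (2 * n).+1) + (15 * powb k d (n + (2 * n).+1) + 8)))).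
have [k' [d' pE]] : polyb p by rewrite /p; poly_tac.
pose C := stash A ;; frame_bits ;; unstash ;; c ;; unframe_bits.
exists (stack_machine (compile 0 C)), (k' * 2 ^ d'), d' => x Dx.
set n := size (inp x).
have [sa su] : size (code (a x)) <= n /\ size (u x) <= n.
  by rewrite /n inpE size_cat; split; lia.
have szau : size (code (a x, u x)) <= n + (2 * n).+1.
  by rewrite size_code_pair size_code_bits; lia.
have [t le_t rC] : runs C (bits (inp x), [::], [::]) (bits (out x), [::], [::]) (p n).
  rewrite inpE bits_cat.
  apply: runs_seq; first by apply: runs_le (runs_stash _ _ _ _) _; lia.
  apply: runs_seq; first by apply: runs_le (runs_frame_bits _ _ _) _; lia.
  apply: runs_seq; first by apply: runs_le (runs_unstash _ _ _ _) _; lia.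
  rewrite -bits_cat -[_ ++ _]/(code (a x, u x)) -[bits (code _)]cats0.
  apply: runs_seq.
    by apply: runs_le (cP _ _ _ _) _; exact: powb_mono.
  rewrite -fab // -[bits (f _)]cats0.
  apply: runs_le (runs_unframe_bits _ _ _ _) _.
  have := leq_trans (szf (a x, u x)) (powb_mono k d szau).
  by rewrite size_code_bits; lia.
apply: run_outputs_within rC _.
by apply: leq_trans le_t (leq_trans (pE n) (powb_bound _ _ _)).
Qed.

(** The cases follow the syntax of the function body. Constants are tried before [S] and [cons], so
    closed numerals and lists are not taken apart; conditionals are the fallback. *)
Ltac pt :=
  cbv beta;
  lazymatch goal with
  | |- ptime (fun x => x) => apply: pt_id
  | |- @ptime ?A ?B (fun x => (@?f x, @?g x)) =>
      refine (@pt_pair A _ _ f g _ _); pt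
  | |- @ptime ?A ?B (fun x => fst (@?f x)) =>
      refine (@pt_proj1 A _ _ f _); pt
  | |- @ptime ?A ?B (fun x => snd (@?f x)) =>
      refine (@pt_proj2 A _ _ f _); pt
  | |- @ptime ?A ?B (fun x => flatten (map (@?f x) (@?l x))) =>
      refine (@pt_flatmap A _ _ l f _ _); pt
  | |- @ptime ?A ?B (fun x => map (@?f x) (@?l x)) =>
      refine (@pt_map A _ _ l f _ _); pt
  | |- @ptime ?A ?B (fun x => filter (@?f x) (@?l x)) =>
      refine (@pt_filter A _ l f _ _); pt
  | |- @ptime ?A ?B (fun x => has (@?f x) (@?l x)) =>
      refine (@pt_has A _ l f _ _); pt
  | |- @ptime ?A ?B (fun x => iota 0 (@?f x)) =>
      refine (@pt_iota A f _); pt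
  | |- @ptime ?A ?B (fun x => nth _ (@?l x) (@?i x)) =>
      refine (@pt_nth A B _ l i _ _); pt
  | |- @ptime ?A ?B (fun x => size (@?f x)) =>
      refine (@pt_size A _ f _); pt
  | |- @ptime ?A ?B (fun x => nilp (@?f x)) =>
      refine (@pt_eqnil A _ f _); pt
  | |- @ptime ?A ?B (fun x => cat (@?f x) (@?g x)) =>
      refine (@pt_cat A _ f g _ _); pt
  | |- @ptime ?A ?B (fun x => ~~ (@?f x)) => refine (@pt_negb A f _); pt
  | |- @ptime ?A ?B (fun x => (@?f x) && (@?g x)) =>
      refine (@pt_andb A f g _ _); pt
  | |- @ptime ?A ?B (fun x => (@?f x) || (@?g x)) =>
      refine (@pt_orb A f g _ _); pt
  | |- @ptime ?A ?B (fun x => addn (@?f x) (@?g x)) =>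
      refine (@pt_addn A f g _ _); pt
  | |- @ptime ?A ?B (fun x => muln (@?f x) (@?g x)) =>
      refine (@pt_muln A f g _ _); pt
  | |- @ptime ?A ?B (fun x => @eq_op _ (@?f x) (@?g x)) =>
      first [refine (@pt_eqn A f g _ _) | refine (@pt_eqb A f g _ _)]; pt
  | |- ptime (fun _ => ?c) => apply: pt_const
  | |- @ptime ?A ?B (fun x => S (@?f x)) => refine (@pt_succ A f _); pt
  | |- @ptime ?A ?B (fun x => cons (@?f x) (@?g x)) =>
      refine (@pt_cons A _ f g _ _); pt
  | _ => apply: pt_if; pt
  end.

(** * From hedge graphs to Horn formulas *)

(** The pairs nest to the right so that the canonical codes coincide with [enc_hedge_graph] and
    [enc_horn_formula]. *)
Notation raw_edge := (nat * (nat * nat))%type.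
Notation raw_graph := (nat * (nat * seq raw_edge))%type.
Notation raw_literal := (bool * nat)%type.
Notation raw_clause := (seq raw_literal).
Notation raw_formula := (nat * seq raw_clause)%type.

Definition joins (u v : nat) (e : raw_edge) : bool :=
  (e.1 == u) && (e.2.1 == v) || (e.1 == v) && (e.2.1 == u).

(** In a simple graph this list has at most one entry; it plays the part of an optional hedge. *)
Definition hedges_between (es : seq raw_edge) (u v : nat) : seq nat :=
  [seq e.2.2 | e <- es & joins u v e].

(* With [h] hedges, the variables [h] and [h.+1] stand for the constants 1 and
   0; [h] is only forced to be 1 when there is an induced path, so that an
   instance of optimum 0 is mapped to an instance of optimum 0. *)
Definition or_clauses (h a b : nat) : seq raw_clause :=
  if a == b then [:: [:: (true, a)]]
  else [:: [:: (true, h)]; [:: (true, a); (true, b); (false, h)]].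

(** If [a = b], a literal would be repeated; its second occurrence is replaced by the variable
    [h.+1], which [graph_formula] forces to 0. *)
Definition imp_clause (h a b c : nat) : raw_clause :=
  if a == b then [:: (false, c); (true, a); (true, h.+1)]
  else [:: (false, c); (true, a); (true, b)].

Definition pair_clauses (h : nat) (cs : seq nat) (a b : nat) : seq raw_clause :=
  if nilp cs then or_clauses h a b else [seq imp_clause h a b c | c <- cs].

Definition triple_clauses (h : nat) (es : seq raw_edge) (u v w : nat) :=
  if u == w then [::] else
  flatten [seq flatten [seq pair_clauses h (hedges_between es u w) a b
                       | b <- hedges_between es v w]
          | a <- hedges_between es u v].

Definition path_clauses (H : raw_graph) : seq raw_clause :=
  flatten [seq flatten [seq flatten [seq triple_clauses H.2.1 H.2.2 u v w
    | w <- iota 0 H.1] | v <- iota 0 H.1] | u <- iota 0 H.1].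

Definition graph_formula (H : raw_graph) : raw_formula :=
  (H.2.1.+2, [:: (false, H.2.1.+1)] :: path_clauses H).

Lemma pt_graph_formula : ptime graph_formula.
Proof.
rewrite /graph_formula /path_clauses /triple_clauses /pair_clauses /or_clauses.
rewrite /imp_clause /hedges_between /joins.
pt.
Qed.

Definition restriction (x : raw_graph * seq bool) : seq bool :=
  [seq nth false x.2 i | i <- iota 0 x.1.2.1].

Lemma pt_restriction : ptime restriction.
Proof. rewrite /restriction; pt. Qed.

(** * From Horn formulas to hedge graphs *)

Definition gadget := (bool * (nat * (nat * nat)))%type.

(* A gadget is a graph on three fresh vertices.  [triangle a b c] has one edge
   in each of the hedges [a], [b], [c] and allows any number of them to be
   deleted but one; so [triangle a a b] says that if [b] is deleted, so is [a].
   [forced a] is a path with both edges in [a], the last [a] being a dummy. *)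
Notation triangle a b c := (true, (a, (b, c))).
Notation forced a := (false, (a, (a, a))).

(* Every variable gets more copies than there are clauses, to outweigh the cost
   of the auxiliary hedges. *)
Definition copies (F : raw_formula) : nat := (size F.2).+1.

(** Copy 0 of [x] is [x] itself. The copies form blocks of length [F.1], so remainder and quotient
    decode them. *)
Definition copy (F : raw_formula) (x j : nat) : nat := x + j * F.1.

Definition aux (F : raw_formula) (k : nat) : nat := F.1 * copies F + k.

Definition copy_gadgets (F : raw_formula) : seq gadget :=
  flatten [seq flatten [seq
    [:: triangle x x (copy F x j); triangle (copy F x j) (copy F x j) x]
    | x <- iota 0 F.1] | j <- iota 0 (copies F)].

(* Deleting a variable that has to be 0 forces all variables to be deleted: such
   a cut is so expensive that any model is a good enough answer to it. *)
Definition unit_gadgets (n : nat) (l : raw_literal) : seq gadget :=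
  if l.1 then [:: forced l.2] else [seq triangle y y l.2 | y <- iota 0 n].

(** Ranging over all ordered pairs of literals avoids locating the negated one; the two positive
    literals produce the same constraint twice. *)
Definition pair_gadgets (a : nat) (l1 l2 : raw_literal) : seq gadget :=
  if l1.1 && l2.1 && ~~ (l1.2 == l2.2) then [:: triangle a l1.2 l2.2]
  else [::].

(* The hedge [a] of a clause z -> x \/ y is a proxy for x \/ y: the gadgets say
   z -> a, and not exactly one of a, x, y. *)
Definition clause_gadgets (n a : nat) (c : raw_clause) : seq gadget :=
  triangle a a a ::
  if size c == 1 then flatten [seq unit_gadgets n l | l <- c] else
  flatten [seq flatten [seq pair_gadgets a l1 l2 | l2 <- c] | l1 <- c] ++
  [seq triangle a a l.2 | l <- [seq l <- c | ~~ l.1]].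

Definition gadgets (F : raw_formula) : seq gadget :=
  copy_gadgets F ++
  flatten [seq clause_gadgets F.1 (aux F k) (nth [::] F.2 k)
          | k <- iota 0 (size F.2)].

Definition gadget_edges (i : nat) (g : gadget) : seq raw_edge :=
  [:: (3 * i, ((3 * i).+1, g.2.1)); (3 * i, ((3 * i).+2, g.2.2.1))] ++
  (if g.1 then [:: ((3 * i).+1, ((3 * i).+2, g.2.2.2))] else [::]).

Definition gadget_graph (h : nat) (gs : seq gadget) : raw_graph :=
  (3 * size gs,
   (h, flatten [seq gadget_edges i (nth (forced 0) gs i)
               | i <- iota 0 (size gs)])).

Definition formula_graph (F : raw_formula) : raw_graph :=
  gadget_graph (F.1 * copies F + size F.2) (gadgets F).

Lemma pt_gadgets : ptime gadgets.
Proof.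
rewrite /gadgets /copy_gadgets /clause_gadgets /pair_gadgets /unit_gadgets.
rewrite /aux /copy /copies; pt.
Qed.

Lemma pt_gadget_graph : ptime (fun x : nat * seq gadget => gadget_graph x.1 x.2).
Proof. rewrite /gadget_graph /gadget_edges; pt. Qed.

Lemma pt_formula_graph : ptime formula_graph.
Proof.
apply: (@pt_comp _ (nat * seq gadget)%type _ (fun x => gadget_graph x.1 x.2)
  (fun F => (F.1 * copies F + size F.2, gadgets F))).
  exact: pt_gadget_graph.
rewrite /copies; apply: pt_pair pt_gadgets; pt.
Qed.

Definition refutes (a : seq bool) (c : raw_clause) : bool :=
  ~~ has (fun l => nth false a l.2 == l.1) c.

(* One round of parallel unit propagation: x is set to 0 if it occurs negated
   in a clause that [a] falsifies. *)
Definition propagate (cs : seq raw_clause) (a : seq bool) : seq bool :=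
  [seq nth false a x &&
       ~~ has (fun c => has (fun l => ~~ l.1 && (l.2 == x)) c && refutes a c) cs
  | x <- iota 0 (size a)].

(** A round that changes anything sets at least one variable to 0, so as many rounds as there are
    variables reach a fixpoint. *)
Definition restricted_model (x : raw_formula * seq bool) : seq bool :=
  iter x.1.1 (propagate x.1.2) [seq nth false x.2 i | i <- iota 0 x.1.1].

Lemma size_propagate cs a : size (propagate cs a) = size a.
Proof. by rewrite size_map size_iota. Qed.

Lemma pt_restricted_model : ptime restricted_model.
Proof.
apply: (@pt_iter (raw_formula * seq bool)%type (seq raw_clause) (seq bool)
  propagate (fun n => 2 * n + 1) (fun x => x.1.2)
  (fun x => [seq nth false x.2 i | i <- iota 0 x.1.1]) (fun x => x.1.1)).
- pt.
- pt.
- pt.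
- rewrite /propagate /refutes; pt.
- by poly_tac.
move=> cs s n; rewrite size_code_bits; have -> : size (iter n (propagate cs) s) = size s.
  by elim: n => //= n; rewrite size_propagate.
rewrite !size_code_pair addn1 ltnS leq_mul2l /=.
exact: leq_trans (size_le_code s) (leq_trans (leq_addr _ _) (leq_addl _ _)).
Qed.

(** * A criterion for A-reducibility *)

Lemma optimum_exists (P : min_problem) (I : inst P) (S : sol I) :
  feasible S -> exists v, optimum I v.
Proof.
move=> fS; pose p v := `[< exists2 S : sol I, feasible S & cost S = v >].
have ex_p : exists v, p v by exists (cost S); apply/asboolP; exists S.
case: (ex_minnP ex_p) => v /asboolP pv min_v; exists v; split=> // T fT.
by apply: min_v; apply/asboolP; exists T.
Qed.

(* [N I] is the factor by which the reduction blows up costs. *)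
Lemma A_reduces_scaled (R : realType) (P Q : min_problem) (F : inst P -> inst Q)
    (G : forall I, sol (F I) -> sol I) (N : inst P -> nat) :
  polytime (fun=> True) (fun I => enc_inst I) (fun I => enc_inst (F I)) ->
  polytime (fun x : {I : inst P & sol (F I)} => feasible (projT2 x))
    (fun x => enc_inst (projT1 x) ++ enc_sol (projT2 x))
    (fun x => enc_sol (G (projT1 x) (projT2 x))) ->
  (forall I, 0 < N I) ->
  (forall I (S : sol (F I)), feasible S ->
     feasible (G I S) /\ N I * cost (G I S) <= cost S) ->
  (forall I (T : sol I), feasible T ->
     exists2 S : sol (F I), feasible S & cost S <= 2 * N I * cost T) ->
  A_reduces R P Q.
Proof.
move=> Fpoly Gpoly N_gt0 down up; exists F, G, 2%R; split=> //.
  by move=> I S /down[].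
move=> I r S r_ge1 [fS [v [_ v_min] Sv]]; have [fG GS] := down I S fS.
split=> //; have [w opt_w] := optimum_exists fG; exists w => //.
have [[T fT Tw] _] := opt_w; have [S' fS' S'T] := up I T fT.
(* Now [N I * cost (G I S) <= cost S <= r * v <= r * 2 * N I * w], and cancelling [N I] leaves the
   factor 2. *)
have vw : v <= 2 * N I * w by rewrite -Tw; exact: leq_trans (v_min _ fS') S'T.
have N0 : (0 < (N I)%:R :> R)%R by rewrite ltr0n.
rewrite -(ler_pM2l N0) -natrM.
apply: (@le_trans _ _ ((cost S)%:R)%R); first by rewrite ler_nat.
apply: (le_trans Sv).
apply: (@le_trans _ _ (r * (2 * N I * w)%:R)%R).
  by rewrite ler_wpM2l ?ler_nat // (le_trans ler01).
by rewrite !natrM le_eqVlt; apply/orP; left; apply/eqP; ring.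
Qed.

(** * Cluster graphs *)

(** The right-hand side makes the reflexive closure of adjacency an equivalence relation, whose
    classes are the cliques; conversely, two blocks sharing [v] coincide. *)
Lemma cliquesP (V : finType) (adj : rel V) : symmetric adj -> irreflexive adj ->
  disjoint_union_of_cliques adj <->
  (forall u v w, u != w -> adj u v -> adj v w -> adj u w).
Proof.
move=> symA irrA; split=> [[P /and3P[/eqP covP trivP _] adjE] u v w uw|trA].
  rewrite !adjE uw => /andP[_ /existsP[B /and3P[PB Bu Bv]]].
  move=> /andP[_ /existsP[B' /and3P[PB' Bv' Bw]]]; apply/existsP; exists B.
  suff eqB : B = B' by rewrite PB Bu eqB Bw.
  apply/eqP/idPn => nB; have /disjointFr/(_ Bv) := trivIsetP trivP B B' PB PB' nB.
  by rewrite Bv'.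
pose R := [rel x y | (x == y) || adj x y].
have eqR : {in [set: V] & &, equivalence_rel R}.
  move=> x y z _ _ _; rewrite /= eqxx; split=> // /predU1P[-> //|xy].
  apply/orP/orP => -[/eqP <-|xz]; rewrite 1?[adj y x]symA ?xy; auto.
  - have [|yz] := eqVneq y z; [by left|right].
    by apply: (trA y x z) => //; rewrite symA.
  - have [|xz'] := eqVneq x z; [by left|right].
    exact: (trA x y z).
exists (equivalence_partition R [set: V]).
  exact: equivalence_partitionP.
move=> x y; have [<-|xy] := eqVneq x y; first by rewrite irrA.
have pR z : pblock (equivalence_partition R [set: V]) z \in
    equivalence_partition R [set: V].
  apply: pblock_mem; have /and3P[/eqP -> _ _] := equivalence_partitionP eqR.
  by rewrite inE.
have inE z t : (t \in pblock (equivalence_partition R [set: V]) z) = R z t.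
  by rewrite pblock_equivalence_partition ?inE.
apply/idP/existsP => [Axy|[B /and3P[PB xB yB]]].
  exists (pblock (equivalence_partition R [set: V]) x).
  by rewrite pR !inE /= eqxx Axy orbT.
have /and3P[_ trivP _] := equivalence_partitionP eqR.
move: yB; rewrite -(def_pblock trivP PB xB) inE /= (negPf xy); exact.
Qed.

Section RawGraph.
Variable H : hedge_graph.

Definition raw_edge_of (e : 'I_(hg_order H) * 'I_(hg_order H) * 'I_(hg_hedges H))
  : raw_edge := (val e.1.1, (val e.1.2, val e.2)).

Definition raw_edges : seq raw_edge := map raw_edge_of (hg_edges H).

Definition raw_graph_of : raw_graph := (hg_order H, (hg_hedges H, raw_edges)).

Lemma code_raw_graph : code raw_graph_of = enc_hedge_graph H.
Proof.
rewrite /enc_hedge_graph; do 2 (congr cat); congr rcons.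
by rewrite -map_comp.
Qed.

End RawGraph.

Definition raw_adj (es : seq raw_edge) (d : nat -> bool) (u v : nat) : bool :=
  has (fun h => ~~ d h) (hedges_between es u v).

Lemma joinsC u v e : joins u v e = joins v u e.
Proof. by rewrite /joins orbC. Qed.

Lemma raw_adjC es d u v : raw_adj es d u v = raw_adj es d v u.
Proof. by rewrite /raw_adj /hedges_between (eq_filter (joinsC u v)). Qed.

Definition raw_cluster (n : nat) (es : seq raw_edge) (d : nat -> bool) : Prop :=
  forall u v w, u < n -> v < n -> w < n -> u != w ->
    raw_adj es d u v -> raw_adj es d v w -> raw_adj es d u w.

Lemma hg_deleteE (H : hedge_graph) (U : {set 'I_(hg_hedges H)})
    (d : nat -> bool)
    (u v : 'I_(hg_order H)) :
  (forall h : 'I_(hg_hedges H), d h = (h \in U)) ->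
  hg_delete U u v = raw_adj (raw_edges H) d u v.
Proof.
move=> dE; rewrite /raw_adj /hedges_between has_map has_filter.
rewrite -filter_predI -has_filter has_map; apply: eq_has => -[[x y] h] /=.
by rewrite /joins /= dE !xpair_eqE.
Qed.

Lemma raw_adj_irr (H : hedge_graph) d u : raw_adj (raw_edges H) d u u = false.
Proof.
apply/negP => /hasP[_ /mapP[e' + _] _]; rewrite mem_filter => /andP[+ /mapP[e He ee]].
have := allP (hg_oriented H) e He; rewrite ee /joins /=.
by move=> lt /orP[] /andP[/eqP e1 /eqP e2]; move: lt; rewrite e1 e2 ltnn.
Qed.

Lemma hedge_feasibleP (H : hedge_graph) (U : {set 'I_(hg_hedges H)})
    (d : nat -> bool) :
  (forall h : 'I_(hg_hedges H), d h = (h \in U)) ->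
  disjoint_union_of_cliques (hg_delete U) <->
  raw_cluster (hg_order H) (raw_edges H) d.
Proof.
move=> dE; have adjE := fun u v => @hg_deleteE H U d u v dE.
split=> [/cliquesP cl|cl].
  move=> u v w un vn wn uw.
  have := cl _ _ (Ordinal un) (Ordinal vn) (Ordinal wn); rewrite !adjE; apply=> //.
  - by move=> x y; rewrite !adjE raw_adjC.
  - by move=> x; rewrite adjE raw_adj_irr.
apply/cliquesP.
- by move=> x y; rewrite !adjE raw_adjC.
- by move=> x; rewrite adjE raw_adj_irr.
by move=> u v w uw; rewrite !adjE; exact: cl.
Qed.

(** * Raw descriptions of formulas and graphs *)

Lemma seq_lift (A B : Type) (f : A -> B) (P : pred B) :
  (forall b, P b -> {a | f a = b}) -> forall s, all P s -> {s' | map f s' = s}.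
Proof.
move=> lift; elim=> [|b s IH] /=; first by exists [::].
case/andP=> /lift[a <-] /IH[s' <-]; by exists (a :: s').
Qed.

Definition raw_literal_of n (l : literal n) : raw_literal := (l.1, val l.2).

Definition raw_formula_of (f : horn_formula) : raw_formula :=
  (hf_vars f, [seq [seq raw_literal_of l | l <- c] | c <- hf_clauses f]).

Lemma code_raw_formula f : code (raw_formula_of f) = enc_horn_formula f.
Proof.
rewrite /enc_horn_formula; congr cat; congr rcons.
rewrite -map_comp; congr flatten; apply: eq_map => c /=; congr cons.
by congr rcons; rewrite -map_comp.
Qed.

Definition raw_horn (c : raw_clause) : bool :=
  uniq c && ((size c == 1) || (size c == 3) && (count (fun l => ~~ l.1) c == 1)).

Definition raw_sat (s : nat -> bool) (cs : seq raw_clause) : bool :=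
  all (has (fun l : raw_literal => s l.2 == l.1)) cs.

Lemma raw_literal_inj n : injective (@raw_literal_of n).
Proof. by move=> [b x] [c y] [-> /val_inj ->]. Qed.

Lemma raw_hornE n (c : seq (literal n)) :
  raw_horn [seq raw_literal_of l | l <- c] = horn_clause c.
Proof.
by rewrite /raw_horn /horn_clause (map_inj_uniq (@raw_literal_inj n)) size_map count_map.
Qed.

Lemma satisfiesE n (a : {ffun 'I_n -> bool}) (s : nat -> bool) cs :
  (forall x : 'I_n, s x = a x) ->
  satisfies a cs = raw_sat s [seq [seq raw_literal_of l | l <- c] | c <- cs].
Proof.
move=> sa; rewrite /raw_sat all_map; apply: eq_all => c /=.
by rewrite has_map; apply: eq_has => l /=; rewrite sa.
Qed.

(** The typed instance is provided as data, so that a reduction can be defined as its projection and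
    still have the code computed on raw data. *)
Lemma horn_formula_lift (F : raw_formula) :
  all raw_horn F.2 -> all (all (fun l : raw_literal => l.2 < F.1)) F.2 ->
  (exists s, raw_sat s F.2) -> {f | raw_formula_of f = F}.
Proof.
case: F => n cs /= horn_cs bound_cs sat_cs.
have [|cs' cs'E] := @seq_lift _ _ (map (@raw_literal_of n)) _ _ cs bound_cs.
  apply: seq_lift => -[b x] /= xn; by exists (b, Ordinal xn).
have shape : all (@horn_clause n) cs'.
  by rewrite -(eq_all (@raw_hornE n)) -all_map cs'E.
have sat : [exists a, satisfies a cs'].
  case: sat_cs => s sat_s; apply/existsP; exists [ffun x : 'I_n => s x].
  by rewrite (@satisfiesE _ _ s) ?cs'E // => x; rewrite ffunE.
by exists (HornFormula shape sat); rewrite /raw_formula_of /= cs'E.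
Qed.

Lemma hedge_graph_lift (H : raw_graph) :
  all (fun e : raw_edge => [&& e.1 < e.2.1, e.2.1 < H.1 & e.2.2 < H.2.1]) H.2.2 ->
  uniq [seq (e.1, e.2.1) | e <- H.2.2] ->
  {subset iota 0 H.2.1 <= [seq e.2.2 | e <- H.2.2]} ->
  {G | raw_graph_of G = H}.
Proof.
case: H => n [h es] /= valid_es uniq_es all_h.
pose raw (e : 'I_n * 'I_n * 'I_h) : raw_edge := (val e.1.1, (val e.1.2, val e.2)).
have [|es' es'E] := @seq_lift _ _ raw _ _ es valid_es.
  move=> [u [v x]] /= uvx.
  have xh : x < h by case/and3P: uvx.
  have vn : v < n by case/and3P: uvx.
  have un : u < n by case/and3P: uvx => /ltn_trans h' /h'.
  by exists (Ordinal un, Ordinal vn, Ordinal xh).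
have oriented : all (fun e : 'I_n * 'I_n * 'I_h => e.1.1 < e.1.2) es'.
  apply/allP => e e_es; have := allP valid_es (raw e).
  by rewrite -es'E map_f // => /(_ isT) /and3P[].
have simple : uniq [seq e.1 | e <- es'].
  move: uniq_es; rewrite -es'E -map_comp.
  rewrite (_ : map _ es' = [seq (val p.1, val p.2) | p <- [seq e.1 | e <- es']]).
    exact: map_uniq.
  by rewrite -map_comp.
have nonempty : [forall x, x \in [seq e.2 | e <- es']].
  apply/forallP => x; have /(_ (val x)) := all_h.
  rewrite mem_iota /= add0n ltn_ord => /(_ isT).
  rewrite -es'E -map_comp => /mapP[e e_es /val_inj ->].
  by apply/mapP; exists e.
exists (HedgeGraph oriented simple nonempty).
by rewrite /raw_graph_of /raw_edges /= -es'E.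
Qed.

Lemma nth_map_enum n (f : 'I_n -> bool) (x : 'I_n) :
  nth false [seq f y | y <- enum 'I_n] x = f x.
Proof. by rewrite (nth_map x) ?nth_ord_enum // size_enum_ord. Qed.

Lemma map_iota_enum n (f : nat -> bool) :
  [seq f i | i <- iota 0 n] = [seq f (val x) | x <- enum 'I_n].
Proof. by rewrite -val_enum_ord -map_comp. Qed.

Lemma card_count n (p : nat -> bool) :
  #|[set x : 'I_n | p x]| = count p (iota 0 n).
Proof.
rewrite -sum1_count -sum1_card; under eq_bigl do rewrite inE.
by rewrite -(big_mkord p (fun=> 1)) /index_iota subn0.
Qed.

(** * Correctness of the reduction to Horn formulas *)

Lemma mem_hedges_between es u v a :
  reflect (exists2 e, e \in es & joins u v e /\ a = e.2.2)
          (a \in hedges_between es u v).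
Proof.
apply: (iffP mapP) => [[e +->]|[e e_es [je ->]]].
  by rewrite mem_filter => /andP[je e_es]; exists e.
by exists e; rewrite // mem_filter je.
Qed.

Lemma path_clausesP (H : raw_graph) c :
  c \in path_clauses H -> exists u v w a b,
  [/\ [/\ u < H.1, v < H.1, w < H.1 & u != w],
      a \in hedges_between H.2.2 u v, b \in hedges_between H.2.2 v w &
      c \in pair_clauses H.2.1 (hedges_between H.2.2 u w) a b].
Proof.
move=> /flatten_mapP[u]; rewrite mem_iota => un.
move=> /flatten_mapP[v]; rewrite mem_iota => vn.
move=> /flatten_mapP[w]; rewrite mem_iota => wn.
rewrite /triple_clauses; case: eqP => // /eqP uw.
by move=> /flatten_mapP[a aH] /flatten_mapP[b bH] cP; exists u, v, w, a, b.
Qed.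

Lemma mem_path_clauses (H : raw_graph) u v w a b c :
  u < H.1 -> v < H.1 -> w < H.1 -> u != w ->
  a \in hedges_between H.2.2 u v -> b \in hedges_between H.2.2 v w ->
  c \in pair_clauses H.2.1 (hedges_between H.2.2 u w) a b ->
  c \in path_clauses H.
Proof.
move=> un vn wn uw aH bH cP.
apply/flatten_mapP; exists u; first by rewrite mem_iota.
apply/flatten_mapP; exists v; first by rewrite mem_iota.
apply/flatten_mapP; exists w; first by rewrite mem_iota.
rewrite /triple_clauses (negPf uw).
by apply/flatten_mapP; exists a => //; apply/flatten_mapP; exists b.
Qed.

(** If both edges of a path survive, its clauses are violated when the ends are not joined, and
    otherwise force the hedge of the third edge to survive. *)
Lemma graph_formula_sound (H : raw_graph) s :
  raw_sat s (graph_formula H).2 -> raw_cluster H.1 H.2.2 s.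
Proof.
move=> /= /andP[s0 sat] u v w un vn wn uw /hasP[a aH na] /hasP[b bH nb].
have {}s0 : s H.2.1.+1 = false by move: s0 => /=; case: (s _).
have satP c : c \in pair_clauses H.2.1 (hedges_between H.2.2 u w) a b ->
    has (fun l : raw_literal => s l.2 == l.1) c.
  by move=> /(mem_path_clauses un vn wn uw aH bH) /(allP sat).
move: na nb satP => /negPf na /negPf nb; rewrite /pair_clauses /raw_adj.
case: (hedges_between H.2.2 u w) => [|c cs] /= satP.
  move: satP; rewrite /or_clauses; case: eqP => [_|_] satP.
    by have := satP [:: (true, a)]; rewrite inE eqxx /= na => /(_ isT).
  have := satP [:: (true, a); (true, b); (false, H.2.1)].
  have := satP [:: (true, H.2.1)].
  rewrite !inE !eqxx orbT /= na nb !orbF => /(_ isT) /eqP ->.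
  by move=> /(_ isT).
have := satP (imp_clause H.2.1 a b c); rewrite inE eqxx => /(_ isT).
by rewrite /imp_clause; case: eqP => _ /=; rewrite na ?nb ?s0 !orbF => /eqP ->.
Qed.

(** Orientation makes the stored pair depend only on the two ends, and simplicity then leaves one
    edge. Completeness needs this: adjacency gives some surviving entry of the list, whereas there
    is a clause for every entry. *)
Lemma hedges_between_uniq (H : hedge_graph) u v a b :
  a \in hedges_between (raw_edges H) u v ->
  b \in hedges_between (raw_edges H) u v -> a = b.
Proof.
move=> /mem_hedges_between[_ /mapP[e e_es ->] [je ->]].
move=> /mem_hedges_between[_ /mapP[f f_es ->] [jf ->]].
suff -> : e = f by [].
have le := allP (hg_oriented H) e e_es; have lf := allP (hg_oriented H) f f_es.
have ef : e.1 = f.1.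
  case: e f {e_es f_es} je jf le lf => [[x y] h] [[x' y'] h'] /=.
  rewrite /joins /= => je jf lt lt'; congr pair; apply: val_inj => /=; lia.
have := hg_simple H; elim: (hg_edges H) e_es f_es => //= g es IH.
rewrite !inE => /predU1P[eg|e_es] /predU1P[fg|f_es] /andP[g_es uniq_es].
- by rewrite eg fg.
- by rewrite -eg ef map_f in g_es.
- by rewrite -fg -ef map_f in g_es.
- exact: IH.
Qed.

(** The constant 1 is switched on only by a nonempty cut, and [h.+1] stays 0. *)
Definition extend_cut (h : nat) (d : nat -> bool) (x : nat) : bool :=
  if x < h then d x else (x == h) && has d (iota 0 h).

Lemma hedges_between_lt (H : hedge_graph) u v a :
  a \in hedges_between (raw_edges H) u v -> a < hg_hedges H.
Proof. by case/mem_hedges_between=> _ /mapP[e _ ->] [_ ->] /=. Qed.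

Lemma graph_formula_complete (H : hedge_graph) d :
  raw_cluster (hg_order H) (raw_edges H) d ->
  raw_sat (extend_cut (hg_hedges H) d) (graph_formula (raw_graph_of H)).2.
Proof.
move=> cl; set h := hg_hedges H; set s := extend_cut h d.
have s0 : s h.+1 = false by rewrite /s /extend_cut; case: ltnP => //; lia.
apply/andP; split; first by rewrite /= s0.
apply/allP => c /path_clausesP[u [v [w [a [b [[un vn wn uw] aH bH cP]]]]]].
have ltH := hedges_between_lt.
have sE x y z : x \in hedges_between (raw_edges H) y z -> s x = d x.
  by move=> xH; rewrite /s /extend_cut (hedges_between_lt xH).
have {}cl : d a || d b || raw_adj (raw_edges H) d u w.
  have [//|na] := boolP (d a); have [//|nb] := boolP (d b).
  by apply: (cl u v w) => //; apply/hasP; [exists a|exists b].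
have sa := sE _ _ _ aH; have sb := sE _ _ _ bH.
have s1 : d a || d b -> s h.
  move=> dab; rewrite /s /extend_cut ltnn eqxx /=; apply/hasP.
  case/orP: dab => [da|db]; [exists a|exists b]; rewrite // mem_iota.
    exact: ltH aH.
  exact: ltH bH.
move: cP; rewrite /pair_clauses /raw_adj in cl *; rewrite -/(raw_edges H).
case: nilP cl => [->|_] cl.
  rewrite /= orbF in cl; rewrite /or_clauses; case: eqP => [eab|_].
    by rewrite inE => /eqP -> /=; rewrite sa; move: cl; rewrite eab orbb => ->.
  rewrite !inE => /orP[] /eqP -> /=; first by rewrite s1.
  by rewrite sa sb; case/orP: cl => -> ; rewrite ?orbT.
move=> /mapP[x xC ->]; suff : ~~ s x || (d a || d b).
  rewrite /imp_clause; case: eqP => [<-|_] /=; rewrite ?sa ?sb; rewrite ?s0.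
    by rewrite orbb; case: (s x) => //= ->.
  by case: (s x) => //=; case/orP=> ->; rewrite ?orbT.
have [dab|/negPf dab] := boolP (d a || d b); first by rewrite orbT.
move: cl; rewrite dab /= orbF (sE _ _ _ xC) => /hasP[y yC].
by rewrite (hedges_between_uniq yC xC).
Qed.

(** The last conjunct supplies the model required of an instance: all variables are 1 except the
    constant 0. *)
Lemma path_clauses_shape (H : hedge_graph) c :
  c \in path_clauses (raw_graph_of H) ->
  [&& raw_horn c, all (fun l : raw_literal => l.2 < (hg_hedges H).+2) c
    & has (fun l : raw_literal => (l.2 != (hg_hedges H).+1) == l.1) c].
Proof.
move=> /path_clausesP[u [v [w [a [b [_ aH bH cP]]]]]].
have {}aH := hedges_between_lt aH; have {}bH := hedges_between_lt bH.
move: cP; rewrite /pair_clauses /=; set h := hg_hedges H in aH bH *.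
have a1 : a == h = false by lia.
have b1 : b == h = false by lia.
have a2 : a == h.+1 = false by lia.
have b2 : b == h.+1 = false by lia.
have le1 : h < h.+2 by lia.
have le2 : h.+1 < h.+2 by lia.
have le3 : a < h.+2 by lia.
have le4 : b < h.+2 by lia.
have h2 : h == h.+1 = false by lia.
case: nilP => _.
  rewrite /or_clauses; case: eqP => [_|/eqP/negPf ab].
    by rewrite inE => /eqP ->; rewrite /raw_horn /= le3 a2.
  rewrite !inE => /orP[] /eqP ->; rewrite /raw_horn /= ?inE ?le1 ?le3 ?le4.
    by rewrite h2.
  by rewrite a2 !xpair_eqE ab.
move=> /mapP[x /hedges_between_lt xh ->].
have {}xh : x < h.+2 by apply: (leq_trans xh); lia.
rewrite /imp_clause; case: eqP => [_|/eqP/negPf ab]; rewrite /raw_horn /=;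
  by rewrite !inE !xpair_eqE /= xh le3 ?le2 ?le4 ?a2 ?ab ?orbT.
Qed.

Lemma graph_formula_lift (H : hedge_graph) :
  {f | raw_formula_of f = graph_formula (raw_graph_of H)}.
Proof.
apply: horn_formula_lift.
- apply/allP => c; rewrite inE => /predU1P[-> //|].
  by case/path_clauses_shape/and3P.
- apply/allP => c; rewrite inE => /predU1P[->|]; first by rewrite /= ltnSn.
  by case/path_clauses_shape/and3P.
exists (fun x => x != (hg_hedges H).+1).
apply/allP => c; rewrite inE => /predU1P[->|]; first by rewrite /= eqxx.
by case/path_clauses_shape/and3P.
Qed.

Definition hedge_to_horn (H : hedge_graph) : horn_formula :=
  sval (graph_formula_lift H).

Lemma raw_hedge_to_horn H :
  raw_formula_of (hedge_to_horn H) = graph_formula (raw_graph_of H).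
Proof. exact: svalP (graph_formula_lift H). Qed.

Definition horn_to_cut (H : hedge_graph)
    (a : {ffun 'I_(hf_vars (hedge_to_horn H)) -> bool}) :
    {set 'I_(hg_hedges H)} :=
  [set x : 'I_(hg_hedges H) |
    nth false [seq a y | y <- enum 'I_(hf_vars (hedge_to_horn H))] x].

Lemma hedge_reduces_to_horn (R : realType) :
  A_reduces R HedgeClusterDeletion MinHornDeletion.
Proof.
apply: (@A_reduces_scaled _ HedgeClusterDeletion MinHornDeletion
  hedge_to_horn horn_to_cut (fun=> 1)) => //.
- apply: (@ptime_polytime hedge_graph (fun=> True) _ _ _ raw_graph_of
    (fun H => raw_formula_of (hedge_to_horn H)) _ _ pt_graph_formula) => H /=.
  + by rewrite raw_hedge_to_horn.
  + by rewrite code_raw_graph.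
  + by rewrite code_raw_formula.
- apply: (@ptime_polytime_bits
    {H : hedge_graph & @sol MinHornDeletion (hedge_to_horn H)} _ _ restriction
    (fun x => raw_graph_of (projT1 x)) _ _ (fun x => enc_sol (projT2 x))
    pt_restriction) => -[H a] /=.
  + move=> _; rewrite /restriction /= map_iota_enum; apply: eq_map => x.
    by rewrite inE.
  + by rewrite code_raw_graph.
- move=> H a /=; set n := hf_vars _ in a *.
  pose s := nth false [seq a y | y <- enum 'I_n].
  have nE : n = (hg_hedges H).+2.
    by have := congr1 fst (raw_hedge_to_horn H).
  have sa (x : 'I_n) : s x = a x by exact: nth_map_enum.
  rewrite (satisfiesE _ sa) => sat; split.
    apply/(hedge_feasibleP (d := s)); first by move=> x; rewrite inE.
    apply: (@graph_formula_sound (raw_graph_of H)).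
    by rewrite -raw_hedge_to_horn.
  rewrite mul1n (card_count _ s) (_ : #|_| = count s (iota 0 n)).
    by rewrite nE -addn2 iotaD count_cat leq_addr.
  by rewrite -card_count; apply: eq_card => x; rewrite !inE sa.
- move=> H U /=.
  pose d (x : nat) := [exists y : 'I_(hg_hedges H), (val y == x) && (y \in U)].
  have dU (x : 'I_(hg_hedges H)) : d x = (x \in U).
    apply/existsP/idP => [[y /andP[/eqP/val_inj ->]] //|xU].
    by exists x; rewrite eqxx.
  move=> /(hedge_feasibleP dU)/graph_formula_complete.
  rewrite -raw_hedge_to_horn; set n := hf_vars _; set s := extend_cut _ d => sat.
  have nE : n = (hg_hedges H).+2.
    by have := congr1 fst (raw_hedge_to_horn H).
  exists [ffun x : 'I_n => s x].
    by rewrite (@satisfiesE _ _ s) // => x; rewrite ffunE.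
  have -> : #|[set x | [ffun x : 'I_n => s x] x]| = count s (iota 0 n).
    by rewrite -card_count; apply: eq_card => x; rewrite !inE ffunE.
  have -> : #|U| = count d (iota 0 (hg_hedges H)).
    by rewrite -card_count; apply: eq_card => x; rewrite !inE dU.
  (* Beyond the hedges only the constant 1 can contribute, and only when some hedge is deleted; one
     extra unit is then at most the size of the cut. *)
  rewrite nE -addn2 iotaD count_cat /=.
  rewrite (@eq_in_count _ s d); last first.
    by move=> x; rewrite mem_iota /= add0n => xh; rewrite /s /extend_cut xh.
  rewrite /s /extend_cut add0n ltnn eqxx ltnNge leqnSn /= gtn_eqF //= !addn0.
  by rewrite has_count; case: (count d _) => // k; rewrite /=; lia.
Qed.

(** * Correctness of the reduction to hedge graphs *)

Lemma raw_adjE es d u v :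
  raw_adj es d u v = has (fun e => joins u v e && ~~ d e.2.2) es.
Proof.
rewrite /raw_adj /hedges_between has_map has_filter -filter_predI -has_filter.
by apply: eq_has => e /=; rewrite andbC.
Qed.

(* Whether deleting the hedges in [d] leaves a cluster graph. *)
Definition gadget_ok (d : nat -> bool) (g : gadget) : bool :=
  let: (t, (a, (b, c))) := g in
  if t then d a + d b + d c != 1 else d a || d b.

Definition local_edges (g : gadget) : seq raw_edge :=
  [:: (0, (1, g.2.1)); (0, (2, g.2.2.1))] ++
  (if g.1 then [:: (1, (2, g.2.2.2))] else [::]).

Lemma local_clusterP d g :
  (forall p q r, p < 3 -> q < 3 -> r < 3 -> p != r ->
     raw_adj (local_edges g) d p q -> raw_adj (local_edges g) d q r ->
     raw_adj (local_edges g) d p r) <-> gadget_ok d g.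
Proof.
split=> [cl|].
  have c0 := cl 1 0 2 isT isT isT isT; have c1 := cl 0 1 2 isT isT isT isT.
  have c2 := cl 0 2 1 isT isT isT isT; move: c0 c1 c2.
  rewrite !raw_adjE /local_edges /gadget_ok /joins; case: g {cl} => [[] [a [b c]]] /=;
  case: (d a); case: (d b); try case: (d c) => //=; by move=> *; auto.
move=> ok [|[|[|//]]] [|[|[|//]]] [|[|[|//]]] _ _ _; move: ok;
rewrite !raw_adjE /local_edges /gadget_ok /joins; case: g => [[] [a [b c]]] /=;
case: (d a); case: (d b); try case: (d c) => //=.
Qed.

Lemma gadget_edgesE i g : gadget_edges i g =
  [seq (3 * i + e.1, (3 * i + e.2.1, e.2.2)) | e <- local_edges g].
Proof. by case: g => [[] [a [b c]]]; rewrite /gadget_edges /= !addn0 ?addn1 ?addn2. Qed.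

Lemma local_edges_lt g e : e \in local_edges g -> e.1 < e.2.1 < 3.
Proof.
rewrite /local_edges mem_cat !inE => /orP[/orP[]/eqP -> //|].
by case: g.1; rewrite // inE => /eqP ->.
Qed.

Definition gadget_graph_edges (gs : seq gadget) : seq raw_edge :=
  flatten [seq gadget_edges i (nth (forced 0) gs i) | i <- iota 0 (size gs)].

Lemma eqn_mul3D i j a b : a < 3 -> b < 3 -> 3 * j + a = 3 * i + b -> j = i.
Proof. lia. Qed.

Lemma ltn_mul3D i a m : a < 3 -> i < m -> 3 * i + a < 3 * m.
Proof. lia. Qed.

Lemma raw_adj_gadget gs d i p q : i < size gs -> p < 3 -> q < 3 ->
  raw_adj (gadget_graph_edges gs) d (3 * i + p) (3 * i + q) =
  raw_adj (local_edges (nth (forced 0) gs i)) d p q.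
Proof.
move=> lt_i p3 q3; rewrite !raw_adjE /joins; apply/hasP/hasP => -[e].
  move=> /flatten_mapP[j]; rewrite mem_iota gadget_edgesE => lt_j.
  move=> /mapP[f f_es ->] /= je; have /andP[f1 f2] := local_edges_lt f_es.
  have f3 := ltn_trans f1 f2.
  have ij : j = i.
    by case/andP: je => /orP[]/andP[/eqP ej _] _; exact: eqn_mul3D ej.
  by exists f; [rewrite -ij | move: je; rewrite ij !eqn_add2l].
move=> e_es je; exists (3 * i + e.1, (3 * i + e.2.1, e.2.2)).
  apply/flatten_mapP; exists i; first by rewrite mem_iota.
  by rewrite gadget_edgesE; apply/mapP; exists e.
by rewrite /= !eqn_add2l.
Qed.

Lemma raw_adj_gadget_inv gs d u v : raw_adj (gadget_graph_edges gs) d u v ->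
  exists i p q, [/\ i < size gs, p < 3, q < 3, u = 3 * i + p & v = 3 * i + q].
Proof.
rewrite raw_adjE => /hasP[e /flatten_mapP[i]]; rewrite mem_iota gadget_edgesE.
move=> lt_i /mapP[f f_es ->]; have /andP[f1 f2] := local_edges_lt f_es.
have f3 := ltn_trans f1 f2.
by rewrite /joins /= => /andP[/orP[]/andP[/eqP <- /eqP <-] _]; exists i;
  [exists f.1, f.2.1 | exists f.2.1, f.1].
Qed.

(** Gadgets have disjoint vertex sets, so the middle vertex of a path determines the gadget that
    contains the whole path. *)
Lemma gadget_graph_clusterP gs d :
  raw_cluster (3 * size gs) (gadget_graph_edges gs) d <-> all (gadget_ok d) gs.
Proof.
split=> [cl|/all_nthP ok].
  apply/(all_nthP (forced 0)) => i lt_i; apply/local_clusterP => p q r p3 q3 r3 pr.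
  by rewrite -!raw_adj_gadget //; apply: cl; rewrite ?ltn_mul3D ?eqn_add2l.
move=> u v w _ _ _ uw auv avw.
have [i [p [q [lt_i p3 q3 eu ev]]]] := raw_adj_gadget_inv auv.
have [j [q' [r [lt_j q3' r3 ev' ew]]]] := raw_adj_gadget_inv avw.
have ij : j = i by lia.
have qq : q' = q by lia.
subst j q'; move: uw auv avw; rewrite eu ev ew eqn_add2l !raw_adj_gadget //.
by move/(local_clusterP d _): (ok (forced 0) i lt_i) => cl pr; exact: cl.
Qed.

Lemma uniq_flatten_key (A B : eqType) (f : A -> seq B) (key : B -> A) s :
  uniq s -> (forall i, uniq (f i)) -> (forall i x, x \in f i -> key x = i) ->
  uniq (flatten [seq f i | i <- s]).
Proof.
move=> + uniq_f keyE; elim: s => //= i s IH /andP[i_s /IH uniq_s].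
rewrite cat_uniq uniq_f uniq_s andbT; apply/hasPn => x /flatten_mapP[j j_s xj].
by apply: contra i_s => /keyE <-; rewrite (keyE _ _ xj).
Qed.

(** The covering hypothesis makes every hedge nonempty. The third component carries an edge only in
    a triangle, hence the guard [g.1]. *)
Lemma gadget_graph_lift (h : nat) (gs : seq gadget) :
  all (fun g : gadget => [&& g.2.1 < h, g.2.2.1 < h & g.2.2.2 < h]) gs ->
  (forall x, x < h -> exists2 g : gadget, g \in gs & g.2.1 = x \/ g.1 /\ g.2.2.2 = x) ->
  {G | raw_graph_of G = gadget_graph h gs}.
Proof.
move=> /all_nthP gs_lt all_h; apply: hedge_graph_lift => /=.
- apply/allP => e /flatten_mapP[i]; rewrite mem_iota gadget_edgesE => lt_i.
  have /and3P[a b c] := gs_lt (forced 0) i lt_i.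
  move=> /mapP[f f_es ->] /=; have /andP[f1 f2] := local_edges_lt f_es.
  rewrite ltn_add2l f1 ltn_mul3D //=.
  move: f_es; rewrite /local_edges mem_cat !inE => /orP[/orP[]/eqP -> //|].
  by case: (nth _ _ _).1; rewrite // inE => /eqP ->.
- rewrite map_flatten -map_comp.
  apply: (uniq_flatten_key (key := fun x => x.1 %/ 3)); first exact: iota_uniq.
    move=> i /=; case: (nth _ gs i) => [[] [a [b c]]] /=;
    by rewrite !inE !xpair_eqE; lia.
  move=> i x /mapP[e]; rewrite gadget_edgesE => /mapP[f f_es ->] -> /=.
  have /andP[f1 f2] := local_edges_lt f_es.
  by rewrite mulnC divnMDl // divn_small ?addn0 // (ltn_trans f1).
move=> x; rewrite mem_iota /= add0n => /all_h[g g_gs gx].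
have [i lt_i gE] : exists2 i, i < size gs & g = nth (forced 0) gs i.
  by exists (index g gs); rewrite ?index_mem ?nth_index.
have inE e : e \in gadget_edges i g ->
    e.2.2 \in [seq e.2.2 | e <- gadget_graph_edges gs].
  move=> e_g; apply/mapP; exists e => //; apply/flatten_mapP; exists i.
    by rewrite mem_iota.
  by rewrite -gE.
case: gx => [<-|[g1 <-]].
  by apply: (inE (3 * i, ((3 * i).+1, g.2.1))); rewrite mem_head.
apply: (inE ((3 * i).+1, ((3 * i).+2, g.2.2.2))).
by rewrite /gadget_edges g1 mem_cat mem_head orbT.
Qed.

(** Stating the second case by membership absorbs the three possible positions of the negated
    literal. *)
Lemma raw_hornP c : raw_horn c -> (exists l, c = [:: l]) \/
  size c = 3 /\ exists z x y, x != y /\ c =i [:: (false, z); (true, x); (true, y)].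
Proof.
case: c => [|l1 [|l2 [|l3 [|l4 c]]]]; rewrite /raw_horn ?andbF //=.
  by left; exists l1.
case: l1 l2 l3 => [[] x] [[] y] [[] z] //=; rewrite ?andbF //= !andbT.
all: rewrite !inE !xpair_eqE /=.
- rewrite !orbF => xy; right; split=> //; exists z, x, y; split=> // l.
  by rewrite !inE; do 3 case: (l == _).
- rewrite ?orbF => xy; right; split=> //; exists y, x, z; split=> // l.
  by rewrite !inE; do 3 case: (l == _).
- rewrite ?orbF => xy; right; split=> //; exists x, y, z; split=> // l.
Qed.

Lemma all_flatmap (A B : Type) (P : pred B) (f : A -> seq B) s :
  all P (flatten [seq f i | i <- s]) = all (fun i => all P (f i)) s.
Proof. by elim: s => //= i s IH; rewrite all_cat IH. Qed.

Lemma unit_gadgetsE d n l : all (gadget_ok d) (unit_gadgets n l) =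
  if l.1 then d l.2 else d l.2 ==> all d (iota 0 n).
Proof.
rewrite /unit_gadgets; case: l => [[] x] /=; first by rewrite orbb andbT.
rewrite all_map; case dx: (d x) => /=.
  by apply: eq_all => y /=; rewrite dx; case: (d y).
by apply/allP => y _ /=; rewrite dx; case: (d y).
Qed.

Lemma clause_gadgetsE d n a c z x y :
  x != y -> size c = 3 -> c =i [:: (false, z); (true, x); (true, y)] ->
  all (gadget_ok d) (clause_gadgets n a c) =
  (d a + d x + d y != 1) && (d z ==> d a).
Proof.
move=> xy sz_c cE; rewrite /clause_gadgets sz_c /= all_cat all_flatmap all_map.
rewrite all_filter !(eq_all_r cE) /= !all_flatmap !(eq_all_r cE) /=.
have yx : y != x by rewrite eq_sym.
rewrite /pair_gadgets /= !eqxx xy yx /=.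
by case: (d a) (d x) (d y) (d z) => [] [] [] [].
Qed.

(** Deleting [z] forces [a], which must not be the only one deleted among [a], [x], [y]. A negative
    unit clause can be violated only by deleting all variables, which is the second alternative. *)
Lemma clause_gadgets_sound d n a c : raw_horn c ->
  all (gadget_ok d) (clause_gadgets n a c) ->
  has (fun l : raw_literal => d l.2 == l.1) c \/ all d (iota 0 n).
Proof.
case/raw_hornP=> [[l ->]|[sz_c [z [x [y [xy cE]]]]]].
  rewrite /clause_gadgets /= cats0 unit_gadgetsE => /andP[_].
  by case: l => [[] x] /=; case: (d x) => //=; auto.
rewrite (clause_gadgetsE d n a xy sz_c cE) (eq_has_r cE) /=.
by case: (d a) (d x) (d y) (d z) => [] [] [] []; auto.
Qed.

(** When [a] is the disjunction of [x] and [y], the number deleted among the three is 0 or at least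
    2. *)
Lemma clause_gadgets_complete d n a c : raw_horn c ->
  has (fun l : raw_literal => d l.2 == l.1) c ->
  d a = has (fun l : raw_literal => l.1 && d l.2) c ->
  all (gadget_ok d) (clause_gadgets n a c).
Proof.
case/raw_hornP=> [[l ->]|[sz_c [z [x [y [xy cE]]]]]].
  rewrite /clause_gadgets /= cats0 unit_gadgetsE !orbF => + ->.
  by case: l => [[] x] /=; case: (d x).
rewrite (clause_gadgetsE d n a xy sz_c cE) !(eq_has_r cE) /= => + ->.
by case: (d x) (d y) (d z) => [] [] [].
Qed.

(** * Cuts of the graph of a formula, and their cost *)

Section FormulaGraph.
Variable F : raw_formula.
Hypothesis F_horn : all raw_horn F.2.
Hypothesis F_bound : all (all (fun l : raw_literal => l.2 < F.1)) F.2.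

Local Notation n := F.1.
Local Notation cs := F.2.
Local Notation N := (copies F).
Local Notation K := (n * N + size cs).

Lemma copies_ok d : all (gadget_ok d) (copy_gadgets F) <->
  (forall x j, x < n -> j < N -> d (copy F x j) = d x).
Proof.
rewrite /copy_gadgets all_flatmap; split=> [/allP ok x j xn jN|dE].
  have := ok j; rewrite mem_iota => /(_ jN); rewrite all_flatmap => /allP /(_ x).
  by rewrite mem_iota => /(_ xn) /=; case: (d x); case: (d (copy _ _ _)).
apply/allP => j; rewrite mem_iota => jN; rewrite all_flatmap; apply/allP => x.
by rewrite mem_iota => xn /=; rewrite dE //; case: (d x).
Qed.

Lemma gadgets_ok d : all (gadget_ok d) (gadgets F) <->
  (forall x j, x < n -> j < N -> d (copy F x j) = d x) /\
  (forall k, k < size cs ->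
     all (gadget_ok d) (clause_gadgets n (aux F k) (nth [::] cs k))).
Proof.
rewrite /gadgets all_cat all_flatmap; split=> [/andP[/copies_ok dE /allP ok]|[dE ok]].
  by split=> // k km; apply: ok; rewrite mem_iota.
apply/andP; split; first exact/copies_ok.
by apply/allP => k; rewrite mem_iota; exact: ok.
Qed.

Lemma copy_lt x j : x < n -> j < N -> copy F x j < n * N.
Proof.
move=> xn jN; rewrite /copy mulnC; apply: (@leq_trans (n * j.+1)).
  by rewrite mulnS ltn_add2r.
by rewrite leq_mul2l jN orbT.
Qed.

Lemma copyK h : h < n * N ->
  [/\ h %% n < n, h %/ n < N & copy F (h %% n) (h %/ n) = h].
Proof.
move=> hK; have n0 : 0 < n by case: (n) hK.
by rewrite ltn_mod n0 ltn_divLR // mulnC hK /copy addnC -divn_eq.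
Qed.

Lemma formula_graph_lift : {G | raw_graph_of G = formula_graph F}.
Proof.
have nK x : x < n -> x < K.
  move=> xn; apply: (leq_trans xn); apply: leq_trans (leq_addr _ _).
  exact: leq_pmulr.
have akK k : k < size cs -> aux F k < K by rewrite ltn_add2l.
apply: gadget_graph_lift => [|h hK].
  rewrite /gadgets /copy_gadgets all_cat !all_flatmap; apply/andP; split.
    apply/allP => j; rewrite mem_iota => jN; rewrite all_flatmap; apply/allP => x.
    rewrite mem_iota => xn; have cK : copy F x j < K.
      exact: leq_trans (copy_lt xn jN) (leq_addr _ _).
    by rewrite /= cK nK.
  apply/allP => k; rewrite mem_iota => km; have aK := akK k km.
  have cK l : l \in nth [::] cs k -> l.2 < K.
    by move/(allP (all_nthP [::] F_bound k km))/nK.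
  rewrite /clause_gadgets /= aK /=; case: ifP => _.
    rewrite all_flatmap; apply/allP => l /cK lK; rewrite /unit_gadgets.
    case: l.1; first by rewrite /= lK.
    by rewrite all_map; apply/allP => y; rewrite mem_iota => /nK yK /=; rewrite yK lK.
  rewrite all_cat all_flatmap all_map all_filter; apply/andP; split.
    apply/allP => l /cK lK; rewrite all_flatmap; apply/allP => l' /cK lK'.
    by rewrite /pair_gadgets; case: ifP => // _; rewrite /= aK lK lK'.
  by apply/allP => l /cK lK; apply/implyP => _; rewrite /= aK lK.
have [hN|hN] := ltnP h (n * N).
  have [xn jN hE] := copyK hN.
  exists (triangle (h %% n) (h %% n) (copy F (h %% n) (h %/ n))); last by right.
  rewrite mem_cat; apply/orP; left.
  apply/flatten_mapP; exists (h %/ n); first by rewrite mem_iota.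
  by apply/flatten_mapP; exists (h %% n); rewrite ?mem_iota // mem_head.
(* This triangle imposes nothing; [clause_gadgets] contains it so that the auxiliary hedge is
   nonempty even for a unary clause. *)
exists (triangle h h h); last by left.
rewrite mem_cat; apply/orP; right.
have km : h - n * N < size cs by rewrite ltn_subLR.
apply/flatten_mapP; exists (h - n * N); first by rewrite mem_iota.
by rewrite /aux subnKC // mem_head.
Qed.

Lemma formula_graph_cluster d :
  raw_cluster (formula_graph F).1 (formula_graph F).2.2 d <->
  all (gadget_ok d) (gadgets F).
Proof. exact: gadget_graph_clusterP. Qed.

Lemma formula_graph_sound d : all (gadget_ok d) (gadgets F) ->
  raw_sat d cs \/ all d (iota 0 n).
Proof.
move=> /gadgets_ok[_ ok]; have [//|nall] := boolP (all d (iota 0 n)); first by right.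
left; apply/(all_nthP [::]) => k km.
have [//|all_d] := clause_gadgets_sound (all_nthP [::] F_horn k km) (ok k km).
by rewrite all_d in nall.
Qed.

(** Auxiliary hedges take the value that [clause_gadgets_complete] asks for, which is 0 throughout
    when [s] is 0 on all variables. *)
Definition cut_of (s : nat -> bool) (h : nat) : bool :=
  if h < n * N then s (h %% n)
  else has (fun l : raw_literal => l.1 && s l.2) (nth [::] cs (h - n * N)).

Lemma cut_of_lt s x : x < n -> cut_of s x = s x.
Proof.
move=> xn; rewrite /cut_of modn_small //.
by rewrite (leq_trans xn) // leq_pmulr.
Qed.

Lemma formula_graph_complete s : raw_sat s cs ->
  all (gadget_ok (cut_of s)) (gadgets F).
Proof.
move=> sat; apply/gadgets_ok; split=> [x j xn jN|k km].
  rewrite (@cut_of_lt s x) // /cut_of copy_lt // /copy.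
  by rewrite addnC modnMDl modn_small.
have bound := allP (all_nthP [::] F_bound k km).
apply: clause_gadgets_complete; first exact: (all_nthP [::] F_horn k km).
  have := all_nthP [::] sat k km; congr is_true; apply: eq_in_has => l /bound ln.
  by rewrite cut_of_lt.
rewrite /cut_of /aux ltnNge leq_addr /= addKn; apply: eq_in_has => l /bound ln.
by rewrite -/(cut_of s l.2) cut_of_lt.
Qed.

Lemma count_copies d k : (forall h, h < n * k -> d h = d (h %% n)) ->
  count d (iota 0 (n * k)) = k * count d (iota 0 n).
Proof.
elim: k => [|k IH] dE; first by rewrite muln0.
rewrite mulnS addnC iotaD count_cat IH => [|h hk]; last first.
  by apply: dE; rewrite mulnS ltn_addl.
rewrite mulSn addnC; congr addn; rewrite add0n -[n * k]addn0 iotaDl count_map.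
apply: eq_in_count => x; rewrite mem_iota /= => xn.
by rewrite dE ?(mulnC n) ?modnMDl ?modn_small // mulSn addnC ltn_add2r.
Qed.

(** The copies cost exactly [N] times the model, and the fewer than [N] auxiliary hedges are paid
    for by one more factor [N]. If the model has cost 0, no positive literal holds and they cost
    nothing. *)
Lemma count_cut_le s :
  count (cut_of s) (iota 0 K) <= 2 * N * count s (iota 0 n).
Proof.
rewrite iotaD count_cat add0n count_copies => [|h hN]; last first.
  by rewrite /cut_of hN ifT ?modn_mod //; apply: leq_ltn_trans hN; exact: leq_mod.
rewrite (@eq_in_count _ (cut_of s) s) => [|x]; last first.
  by rewrite mem_iota => xn; rewrite cut_of_lt.
case: (posnP (count s (iota 0 n))) => [c0|c_gt0]; last first.
  rewrite -mulnA mul2n -addnn leq_add2l; apply: leq_trans (leq_pmulr N c_gt0).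
  by apply: leq_trans (count_size _ _) _; rewrite size_iota /copies.
rewrite c0 !muln0 add0n leqn0 -[_ == 0]negbK -lt0n -has_count -all_predC.
apply/allP => h; rewrite mem_iota /= => /andP[hN hK].
rewrite /cut_of ltnNge hN /=; apply/hasPn => l l_c.
have km : h - n * N < size cs by rewrite ltn_subLR.
have ln := allP (all_nthP [::] F_bound _ km) l l_c.
apply/negP => /andP[_ sl]; have : has s (iota 0 n).
  by apply/hasP; exists l.2; rewrite ?mem_iota.
by rewrite has_count c0.
Qed.

Lemma count_cut_ge d : all (gadget_ok d) (gadgets F) ->
  N * count d (iota 0 n) <= count d (iota 0 K).
Proof.
move=> /gadgets_ok[dE _]; rewrite iotaD count_cat count_copies ?leq_addr // => h hN.
by have [xn jN hE] := copyK hN; rewrite -{1}hE dE.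
Qed.

End FormulaGraph.

(** * Unit propagation turns a cut into a model *)

Lemma nth_propagate cs a x : nth false (propagate cs a) x =
  nth false a x &&
  ~~ has (fun c => has (fun l => ~~ l.1 && (l.2 == x)) c && refutes a c) cs.
Proof.
have [xa|ax] := ltnP x (size a); first by rewrite (nth_map 0) ?size_iota ?nth_iota.
by rewrite !nth_default ?size_propagate.
Qed.

Lemma count_lt_pointwise (a b : seq bool) : size a = size b ->
  (forall x, nth false a x -> nth false b x) -> a = b \/ count id a < count id b.
Proof.
elim: a b => [|u a IH] [|v b] //=; first by left.
move=> [sz] ab; have uv : u -> v := ab 0.
have {ab}[->|lt_ab] := IH b sz (fun x => ab x.+1).
  by case: u v uv => [] [] uv /=; first [left; done | right; lia | case: (uv isT)].
by case: u v uv => [] [] uv /=; first [right; lia | case: (uv isT)].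
Qed.

(** The number of entries [true] drops in each round that is not stationary. *)
Lemma decreasing_fix (f : seq bool -> seq bool) :
  (forall a, size (f a) = size a) ->
  (forall a x, nth false (f a) x -> nth false a x) ->
  forall k a, count id a <= k -> f (iter k f a) = iter k f a.
Proof.
move=> szf fle; elim=> [|k IH] a ak.
  by have [//|] := count_lt_pointwise (szf a) (fle a); lia.
have [fa|fa] := count_lt_pointwise (szf a) (fle a); last by rewrite iterSr IH //; lia.
have -> : iter k.+1 f a = a by elim: (k.+1) => //= j ->.
exact: fa.
Qed.

Section Propagate.
Variables (cs : seq raw_clause) (n : nat).
Hypothesis cs_horn : all raw_horn cs.
Hypothesis cs_bound : all (all (fun l : raw_literal => l.2 < n)) cs.

Lemma propagate_model (a : seq bool) :
  raw_sat (nth false a) cs -> propagate cs a = a.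
Proof.
move=> sat; apply: (@eq_from_nth _ false); rewrite size_propagate // => x _.
rewrite nth_propagate; case: hasP => [[c c_cs /andP[_]]|_]; last by rewrite andbT.
by rewrite /refutes (allP sat c c_cs).
Qed.

(** A clause falsified by [a] cannot be satisfied in [s] by a positive literal, as [s] lies below
    [a]. So [s] satisfies it by its only negated literal, and the variable set to 0 is already 0 in
    [s]. *)
Lemma propagate_above s (a : seq bool) : raw_sat s cs ->
  (forall x, x < n -> s x -> nth false a x) ->
  forall x, x < n -> s x -> nth false (propagate cs a) x.
Proof.
move=> sat sa x xn sx; rewrite nth_propagate sa //=; apply/hasPn => c c_cs.
apply/negP => /andP[/hasP[[[] y] // y_c /= /eqP yx] ref_c]; subst y.
have bound := allP (allP cs_bound c c_cs).
have /hasP[[[] y] y_c' /= /eqP sy] := allP sat c c_cs.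
  case/negP: ref_c; apply/hasP; exists (true, y) => //=.
  by rewrite sa // (bound _ y_c').
suff xy : x = y by rewrite -xy sx in sy.
have := allP cs_horn c c_cs.
case/raw_hornP => [[l cl]|[_ [z [u [v [_ cE]]]]]].
  by move: y_c y_c'; rewrite cl !inE => /eqP <- /eqP[].
by move: y_c y_c'; rewrite !cE !inE !xpair_eqE /= !orbF => /eqP -> /eqP ->.
Qed.

(* A clause without negated literals that fails at the fixpoint is a positive
   unit clause, and the model [s] below [a] satisfies it. *)
Lemma propagate_fix_sat s (a : seq bool) : raw_sat s cs ->
  (forall x, x < n -> s x -> nth false a x) -> propagate cs a = a ->
  raw_sat (nth false a) cs.
Proof.
move=> sat sa fix_a; apply/allP => c c_cs; apply/negPn/negP => ref_c.
have bound := allP (allP cs_bound c c_cs).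
have neg_c x : (false, x) \notin c.
  apply/negP => x_c; have ax : nth false a x.
    apply/negPn/negP => nax; case/negP: ref_c; apply/hasP; exists (false, x) => //=.
    by rewrite (negPf nax).
  move: (ax); rewrite -fix_a nth_propagate ax /= => /hasPn/(_ c c_cs).
  rewrite /refutes ref_c andbT => /hasPn/(_ _ x_c).
  by rewrite /= eqxx.
have /hasP[[[] y] y_c /= /eqP sy] := allP sat c c_cs; last first.
  by have := neg_c y; rewrite y_c.
case/negP: ref_c; apply/hasP; exists (true, y) => //=.
by rewrite sa // (bound _ y_c).
Qed.

(** A model is a fixpoint already. The all-ones assignment lies above every model, so propagation
    from it never falls below a given model and stops at a model. *)
Lemma propagate_iter_sat (a : seq bool) : size a = n -> (exists s, raw_sat s cs) ->
  raw_sat (nth false a) cs \/ all (nth false a) (iota 0 n) ->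
  raw_sat (nth false (iter n (propagate cs) a)) cs.
Proof.
move=> sz_a [s sat] [sat_a|all_a].
  have -> // : iter n (propagate cs) a = a.
  by elim: n => //= k ->; exact: propagate_model.
apply: (propagate_fix_sat sat).
  have: forall x, x < n -> s x -> nth false a x.
    by move=> x xn _; apply: (allP all_a); rewrite mem_iota.
  (* Only the number of rounds is generalized; the bound on variables stays [n]. *)
  by elim: {3}n => //= k IH sa; apply: propagate_above (IH sa).
apply: decreasing_fix; first exact: size_propagate.
  by move=> b x; rewrite nth_propagate => /andP[].
by rewrite -sz_a count_size.
Qed.

Lemma propagate_iter_le k (a : seq bool) x :
  nth false (iter k (propagate cs) a) x -> nth false a x.
Proof. by elim: k => //= k IH; rewrite nth_propagate => /andP[/IH]. Qed.

End Propagate.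

Lemma size_propagate_iter cs k a : size (iter k (propagate cs) a) = size a.
Proof. by elim: k => //= k; rewrite size_propagate. Qed.

Lemma raw_formula_shape f :
  [/\ all raw_horn (raw_formula_of f).2,
      all (all (fun l : raw_literal => l.2 < (raw_formula_of f).1)) (raw_formula_of f).2
    & exists s, raw_sat s (raw_formula_of f).2].
Proof.
case: f => n cs shape sat; split=> /=.
- by rewrite all_map (eq_all (@raw_hornE n)).
- by rewrite all_map; apply/allP => c _ /=; rewrite all_map; apply/allP => l _ /=.
case/existsP: sat => a sat; exists (fun x => nth false [seq a y | y <- enum 'I_n] x).
by rewrite -(@satisfiesE _ a) // => x; rewrite nth_map_enum.
Qed.

Definition formula_lift (f : horn_formula) :
    {G | raw_graph_of G = formula_graph (raw_formula_of f)} :=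
  let: And3 _ bound _ := raw_formula_shape f in formula_graph_lift bound.

Definition horn_to_hedge (f : horn_formula) : hedge_graph :=
  sval (formula_lift f).

Lemma raw_horn_to_hedge f :
  raw_graph_of (horn_to_hedge f) = formula_graph (raw_formula_of f).
Proof. exact: svalP (formula_lift f). Qed.

Definition cut_to_model (f : horn_formula)
    (U : {set 'I_(hg_hedges (horn_to_hedge f))}) :
    {ffun 'I_(hf_vars f) -> bool} :=
  [ffun x : 'I_(hf_vars f) => nth false (restricted_model (raw_formula_of f,
     [seq h \in U | h <- enum 'I_(hg_hedges (horn_to_hedge f))])) x].

Lemma horn_reduces_to_hedge (R : realType) :
  A_reduces R MinHornDeletion HedgeClusterDeletion.
Proof.
apply: (@A_reduces_scaled _ MinHornDeletion HedgeClusterDeletion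
  horn_to_hedge cut_to_model (fun f => copies (raw_formula_of f))) => //.
- apply: (@ptime_polytime horn_formula (fun=> True) _ _ _ raw_formula_of
    (fun f => raw_graph_of (horn_to_hedge f)) _ _ pt_formula_graph) => f /=.
  + by rewrite raw_horn_to_hedge.
  + by rewrite code_raw_formula.
  + by rewrite code_raw_graph.
- apply: (@ptime_polytime_bits
    {f : horn_formula & @sol HedgeClusterDeletion (horn_to_hedge f)} _ _
    restricted_model (fun x => raw_formula_of (projT1 x)) _ _
    (fun x => enc_sol (projT2 x)) pt_restricted_model) => -[f U] /=.
  + move=> _; set a := restricted_model _.
    have sz_a : size a = hf_vars f.
      by rewrite size_propagate_iter size_map size_iota.
    rewrite -[LHS](mkseq_nth false) /mkseq sz_a map_iota_enum; apply: eq_map => x.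
    by rewrite ffunE.
  + by rewrite code_raw_formula.
- move=> f U /=; set F := raw_formula_of f; set h := hg_hedges _ in U *.
  have hE : h = F.1 * copies F + size F.2.
    by have := congr1 (fun H => H.2.1) (raw_horn_to_hedge f).
  have [horn bound sat] := raw_formula_shape f.
  set u := [seq x \in U | x <- enum 'I_h]; pose d := nth false u.
  have dU (x : 'I_h) : d x = (x \in U) by rewrite /d nth_map_enum.
  move=> /(hedge_feasibleP dU).
  have := raw_horn_to_hedge f; rewrite -/F => GE.
  rewrite -[raw_edges _]/(raw_graph_of (horn_to_hedge f)).2.2.
  rewrite -[hg_order _]/(raw_graph_of (horn_to_hedge f)).1 GE.
  move=> /formula_graph_cluster ok.
  pose a0 := [seq d x | x <- iota 0 F.1].
  pose a := iter F.1 (propagate F.2) a0.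
  have a0E x : nth false a0 x = (x < F.1) && d x.
    have [xn|nx] := ltnP x F.1; first by rewrite (nth_map 0) ?size_iota ?nth_iota.
    by rewrite nth_default // size_map size_iota.
  have aE (x : 'I_(hf_vars f)) : nth false a x = cut_to_model U x by rewrite ffunE.
  split.
    rewrite (satisfiesE _ aE); apply: propagate_iter_sat => //.
      by rewrite size_map size_iota.
    case: (formula_graph_sound horn ok) => [sat_d|all_d]; [left|right].
      apply/allP => c c_cs; have := allP sat_d c c_cs.
      have bc := allP (allP bound c c_cs).
      by congr is_true; apply: eq_in_has => l /bc ln; rewrite a0E ln.
    by apply/allP => x x_n; rewrite a0E (allP all_d) // andbT; rewrite mem_iota in x_n.
  have -> : #|U| = count d (iota 0 h).
    by rewrite -card_count; apply: eq_card => x; rewrite !inE dU.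
  (* Propagation only lowers the assignment, so each variable set in the model is deleted in the
     cut, together with all its copies. *)
  rewrite hE; apply: leq_trans (count_cut_ge ok); rewrite leq_mul2l; apply/orP; right.
  rewrite (_ : #|_| = count (nth false a) (iota 0 F.1)); last first.
    by rewrite -card_count; apply: eq_card => x; rewrite !inE aE.
  by apply: sub_count => x /propagate_iter_le; rewrite a0E => /andP[].
move=> f a /=; set F := raw_formula_of f.
have [horn bound sat] := raw_formula_shape f.
pose s (x : nat) := nth false [seq a y | y <- enum 'I_(hf_vars f)] x.
have sa (x : 'I_(hf_vars f)) : s x = a x by exact: nth_map_enum.
rewrite (satisfiesE _ sa) => /(formula_graph_complete horn bound) ok.
set h := hg_hedges (horn_to_hedge f).
have GE := raw_horn_to_hedge f; have hE : h = F.1 * copies F + size F.2.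
  by have := congr1 (fun H => H.2.1) GE.
exists [set x : 'I_h | cut_of F s x].
  apply/(hedge_feasibleP (d := cut_of F s)); first by move=> x; rewrite inE.
  rewrite -[raw_edges _]/(raw_graph_of (horn_to_hedge f)).2.2.
  rewrite -[hg_order _]/(raw_graph_of (horn_to_hedge f)).1 GE.
  exact/formula_graph_cluster.
rewrite card_count hE; apply: leq_trans (count_cut_le bound s) _.
rewrite leq_mul2l; apply/orP; right; rewrite -card_count.
by apply: subset_leq_card; apply/subsetP => x; rewrite !inE sa.
Qed.

Theorem theorem4p7 (R : realType) :
  A_complete R HedgeClusterDeletion MinHornDeletion.
Proof.
by split; [exact: hedge_reduces_to_horn | exact: horn_reduces_to_hedge].
Qed.
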